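(* If $\mathbf{F}_2=\langle a,b\rangle$ is a free group on two generators, then for all integers $p\ne 0$ and $n\neq 0$, each of the elements $a^pb^n$ and $a^pba^nb^{-1}$ generates a measure strong free factor of $\mathbf{F}_2$. More generally, in $\mathbf{F}_r=\mathbf{F}_{r-1}*\langle t\rangle$ every element of the form $vtwt^{-1}$ with $v,w\in\mathbf{F}_{r-1}$ nontrivial generates a measure strong free factor of $\mathbf{F}_r$; and in $\mathbf{F}_r=\mathbf{F}_{r-k}*\mathbf{F}_k$ every element of the form $vw$ with $v\in\mathbf{F}_{r-k}$ and $w\in\mathbf{F}_k$ both nontrivial generates a measure strong free factor of $\mathbf{F}_r$.
   Context: $\mathbf{F}_r$ is the free group of rank $r$, and an element generates a measure strong free factor if the cyclic subgroup it generates is one. Let $\mathcal{R}$ be a countable Borel equivalence relation on $X$ with Borel subequivalence relations $\mathcal{R}_1,\mathcal{R}_2$. Write $\mathcal{R}=\mathcal{R}_1*\mathcal{R}_2$ (free product decomposition) if $\mathcal{R}$ is generated by $\mathcal{R}_1\cup\mathcal{R}_2$ and, for every $n\geq1$ and every cyclic sequence $(x_i)_{i\in\mathbf{Z}/2n\mathbf{Z}}$ in $X$ with $(x_{2i},x_{2i+1})\in\mathcal{R}_1$ and $(x_{2i+1},x_{2i+2})\in\mathcal{R}_2$ for all $i$, there is $j$ with $x_j=x_{j+1}$. For a Borel action $a$ of a countable group $\Gamma$ on $X$, $\mathcal{R}_a$ is its orbit equivalence relation and, for $\Lambda\le\Gamma$, $\mathcal{R}_{a(\Lambda)}$ is the orbit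 equivalence relation of the restriction of $a$ to $\Lambda$. A subgroup $\Lambda\le\Gamma$ is a measure strong free factor of $\Gamma$ if for every free Borel action $\Gamma\curvearrowright^a X$ on a standard Borel space and every Borel probability measure $\mu$ on $X$ (not necessarily invariant), there are a $\Gamma$-invariant Borel set $X_0\subseteq X$ of full $\mu$-measure and a Borel subequivalence relation $\mathcal{S}\subseteq(\mathcal{R}_a)_{\restriction X_0}$ such that $(\mathcal{R}_a)_{\restriction X_0}=(\mathcal{R}_{a(\Lambda)})_{\restriction X_0}*\mathcal{S}$. *)

(* Defs.v *)
From HB Require Import structures.
From mathcomp Require Import all_boot all_order all_algebra.
From mathcomp Require Import all_classical all_reals all_analysis.

Set Implicit Arguments.
Unset Strict Implicit.
Unset Printing Implicit Defensive.

Import Order.TTheory GRing.Theory Num.Theory.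

Local Open Scope classical_set_scope.
Local Open Scope group_scope.

Section Groups.
Context {G : groupType}.

Definition subgroup (H : set G) : Prop :=
  H 1 /\ forall g h, H g -> H h -> H (g / h).

Definition gen (A : set G) : set G := smallest subgroup A.

Definition expgz (g : G) (p : int) : G :=
  match p with Posz n => g ^+ n | Negz n => g ^- n.+1 end.

(* The letter [(i, e)] stands for [s`_i] if [e = false], and for its inverse
   if [e = true]. *)
Definition word (s : seq G) : Type := seq ('I_(size s) * bool).

Definition reduced (s : seq G) (w : word s) : bool :=
  sorted (fun k l => ~~ ((k.1 == l.1) && (k.2 != l.2))) w.

Definition eval_word (s : seq G) (w : word s) : G :=
  \prod_(l <- w) (if l.2 then (s`_l.1)^-1 else s`_l.1).

(* [G] is a free group of rank [size s], freely generated by [s]: every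
   element is the value of exactly one reduced word. *)
Definition free_basis (s : seq G) : Prop :=
  forall g : G, exists! w : word s, reduced w /\ eval_word w = g.

End Groups.

Definition polish {R : realType} (Y : metricType R) : Prop :=
  (forall F : set_system Y, ProperFilter F -> cauchy F -> exists y : Y, F --> y) /\
  (exists2 D : set Y, countable D & dense D).

(* The measurable space [X] is Borel isomorphic to a Polish space. *)
Definition standard_borel (R : realType) d (X : measurableType d) : Prop :=
  exists (Y : metricType R) (f : X -> Y),
    [/\ polish Y, bijective f &
        forall A : set Y, <<s open >> A <-> measurable (f @^-1` A)].

Section Relations.
Context {X : Type}.

(* A relation on a subset [X0] of [X] is a set of pairs contained in
   [X0 `*` X0]. *)
Definition equivalence_on (X0 : set X) (E : set (X * X)) : Prop :=
  [/\ E `<=` X0 `*` X0,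
      forall x, X0 x -> E (x, x),
      forall x y, E (x, y) -> E (y, x) &
      forall x y z, E (x, y) -> E (y, z) -> E (x, z)].

Definition restr (X0 : set X) (E : set (X * X)) : set (X * X) :=
  E `&` (X0 `*` X0).

Local Open Scope ring_scope.

(* [E = E1 * E2], for equivalence relations on [X0].  Indices are added in
   Z/2nZ, which is what ['Z_(2 * n)] denotes since [2 * n > 1]. *)
Definition free_product (X0 : set X) (E E1 E2 : set (X * X)) : Prop :=
  E = smallest (equivalence_on X0) (E1 `|` E2) /\
  forall n, (0 < n)%N -> forall x : 'Z_(2 * n) -> X,
    (forall i, E1 (x (i *+ 2), x (i *+ 2 + 1))) ->
    (forall i, E2 (x (i *+ 2 + 1), x (i *+ 2 + 2))) ->
    exists j, x j = x (j + 1).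

End Relations.

Section Actions.
Context {G : groupType} d {X : measurableType d}.

(* For a countable group [G], a Borel action is an action by Borel maps. *)
Definition borel_action (a : G -> X -> X) : Prop :=
  [/\ forall x, a 1 x = x,
      forall g h x, a (g * h) x = a g (a h x) &
      forall g, measurable_fun setT (a g)].

Definition free_action (a : G -> X -> X) : Prop :=
  forall g x, a g x = x -> g = 1.

Definition invariant_set (a : G -> X -> X) (A : set X) : Prop :=
  forall g x, A x -> A (a g x).

Definition orbit_rel (a : G -> X -> X) (L : set G) : set (X * X) :=
  [set xy | exists2 g, L g & a g xy.1 = xy.2].

End Actions.

Definition measure_strong_free_factor (R : realType) (G : groupType)
    (L : set G) : Prop :=
  subgroup L /\
  forall (d : measure_display) (X : measurableType d) (a : G -> X -> X),
    standard_borel R X -> borel_action a -> free_action a ->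
  forall mu : probability X R,
  exists (X0 : set X) (S : set (X * X)),
    [/\ measurable X0, invariant_set a X0 & mu X0 = 1%E] /\
    [/\ measurable S, equivalence_on X0 S,
        S `<=` restr X0 (orbit_rel a setT) &
        free_product X0 (restr X0 (orbit_rel a setT))
                        (restr X0 (orbit_rel a L)) S].

Definition generates_msff (R : realType) (G : groupType) (g : G) : Prop :=
  measure_strong_free_factor R (gen [set g]).

(* Main.v *)
Require Import Defs.
From mathcomp Require Import all_boot all_order all_algebra.
From mathcomp Require Import all_classical all_reals all_analysis.
From mathcomp Require Import zify ring lra.

(** Let c = v w, where v and w are nontrivial elements of subgroups A and B of G such that
    either G is the free product of A and B, or B = t A t^-1 for a stable letter t over
    A.  The second case covers v t w t^-1, with t w t^-1 in B.  For a free
    action of G, the orbit relation R is treed: a point z is an edge between an A-vertex and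
    a B-vertex, shared respectively with the points of A z and of B z.  The triangle
    w^-1 z, z, v z has one side inside the B-vertex of z, one side inside its A-vertex, and a
    third side which is a step of c.  This step makes one of the two attachments of z
    redundant.  Choose a Borel set D, detach every z in D from its A-vertex and
    every z off D from its B-vertex, and let S be the relation of keeping the
    same vertex.  The claim is that R is the free product of the orbit relation of c
    and S, provided that D is chosen well.

    To recover the lost attachment of z from its triangle, the other two corners have to
    keep their vertices in common with z, and one that does not
    is a y with f y = z, where f y = v^-1 y on D and f y = w y off D.  So if f
    strictly increases a rank with values in the lexicographic order of nat * nat,
    then an induction on the rank shows that c and S generate R (cells_generate).  As for freeness, the
    lost attachment of z separates its tree into two sides, S respects
    them, and among the steps of c only those of the triangles of z and of f z can
    cross; so the triangles over a shortest closed walk would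
    form a finite nonempty set closed under f (cells_free).

    It remains to find D with such a rank almost everywhere, for an arbitrary probability
    measure (increasing_choice).  The elements v^-1 and w generate a free semigroup
    (positive_words_inj), so a point has 2^r distinct translates by the positive words of
    length r.  A random colouring then gives very sparse sets that are still met
    by one of these translates of every point (small_hitting_set).
    Take increasingly sparse sets P_n of this kind, with r_n steps leading
    to P_n, such that the points on a path of r_(n+1) steps from P_n to P_(n+1) are of
    summable measure.  By Borel-Cantelli almost every point is on such paths for finitely many n,
    and f follows a path of the last level, which either makes progress on that level
    or reaches a higher one. *)

Set Implicit Arguments.
Unset Strict Implicit.
Unset Printing Implicit Defensive.

Import Order.TTheory GRing.Theory Num.Theory.

Local Open Scope classical_set_scope.
Local Open Scope group_scope.

(** * Subgroups, splittings and positive words *)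

Section Subgroups.
Context {G : groupType}.
Implicit Types (A N : set G) (g h : G).

Lemma subgroup1 A : subgroup A -> A 1. Proof. by case. Qed.
Lemma subgroupV A g : subgroup A -> A g -> A g^-1.
Proof. by case=> A1 AD Ag; rewrite -[g^-1]mul1g; exact: AD. Qed.
Lemma subgroupM A g h : subgroup A -> A g -> A h -> A (g * h).
Proof. by move=> sA Ag Ah; rewrite -[h]invgK; apply: (proj2 sA) => //; exact: subgroupV. Qed.
Lemma subgroupX A g n : subgroup A -> A g -> A (g ^+ n).
Proof.
move=> sA Ag; elim: n => [|n IH]; first by rewrite expg0; exact: subgroup1.
by rewrite expgS; exact: subgroupM.
Qed.

Lemma gen_min A N : subgroup N -> A `<=` N -> gen A `<=` N.
Proof. by move=> sN AN g; apply. Qed.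

Lemma sub_gen A : A `<=` gen A.
Proof. by move=> g Ag N [_]; apply. Qed.

Lemma subgroup_gen A : subgroup (gen A).
Proof.
split=> [N [[N1 _] _]//|g h Ag Ah N [sN AN]].
by apply: (proj2 sN); [exact: Ag|exact: Ah].
Qed.

Lemma gen1P g h : gen [set g] h -> exists n, h = g ^+ n \/ h = g ^- n.
Proof.
suff : gen [set g] `<=` [set h | exists n, h = g ^+ n \/ h = g ^- n] by apply.
apply: gen_min => [|_ ->]; last by exists 1%N; left; rewrite expg1.
have key n m : exists k, g ^+ n * g ^- m = g ^+ k \/ g ^+ n * g ^- m = g ^- k.
  have [mn|/ltnW nm] := leqP m n.
    by exists (n - m)%N; left; rewrite expgnFr.
  by exists (m - n)%N; right; rewrite expgnFr // invgM invgK.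
have comm n m : g ^- n * g ^+ m = g ^+ m * g ^- n.
  by apply: commute_sym; apply: commuteV; apply: commuteX2.
split=> [|x y [n xE] [m yE]]; first by exists 0%N; left.
case: xE yE => -> [] ->; rewrite ?invgK.
- exact: key.
- by exists (n + m)%N; left; rewrite expgnDr.
- by exists (n + m)%N; right; rewrite -invgM -expgnDr addnC.
- by rewrite comm; exact: key.
Qed.
End Subgroups.

Definition torsion_free (G : groupType) := forall (g : G) n, g ^+ n.+1 = 1 -> g = 1.

(** What the proof needs from a decomposition of G as a one-edge graph of groups
    with trivial edge group.  Either G is the free product of A and B, and C is empty; or
    G is generated by A and a stable letter t, and B = t A t^-1, C = t A.  View
    the elements of G as the edges of the Bass-Serre tree, with g joining the
    vertices A g and B g, where in the second case B g is the same vertex as A t^-1 g.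
    Then C consists of the h such that the B-vertex of h g is the A-vertex of g.
    Removing the edge 1 leaves two half-trees, and U is the one at the vertex A.
    So U and 1 together are a union of classes A g, while U is a union of classes
    B g, and the condition on C compares the two classes of one vertex. *)
Record splitting (G : groupType) (A B C U : set G) : Prop := Splitting {
  sp_subgroupA : subgroup A;
  sp_subgroupB : subgroup B;
  sp_notU1 : ~ U 1;
  sp_UA : forall a g, A a -> (U (a * g) \/ a * g = 1 <-> U g \/ g = 1);
  sp_UB : forall b g, B b -> (U (b * g) <-> U g);
  sp_UC : forall h g, C h -> (U (h * g) <-> U g \/ g = 1);
  sp_CA : forall h a, C h -> A a -> C (h * a);
  sp_BC : forall b h, B b -> C h -> C (b * h);
  sp_CVC : forall h k, C h -> C k -> A (h^-1 * k);
  sp_CCV : forall h k, C h -> C k -> B (h * k^-1);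
  sp_gen : forall N, subgroup N -> A `<=` N -> B `<=` N -> C `<=` N -> forall g, N g }.

Section Words.
Context {G : groupType} (al be : G).
Definition letter (l : bool) : G := if l then al else be.
(** The first letter of a word is the first to act on a point, hence the rightmost
    factor: a point travels along the word by dropping letters from its front. *)
Fixpoint eval_seq (s : seq bool) : G :=
  if s is l :: s' then eval_seq s' * letter l else 1.

Lemma eval_seq_cat s t : eval_seq (s ++ t) = eval_seq t * eval_seq s.
Proof. by elim: s => [|l s IH] /=; rewrite ?mulg1 // IH mulgA. Qed.

Lemma eval_seq_rcons s l : eval_seq (rcons s l) = letter l * eval_seq s.
Proof. by rewrite -cats1 eval_seq_cat /= mul1g. Qed.
End Words.

Section PositiveWords.
Context {G : groupType} (A B C U : set G) (sp : splitting A B C U) (tf : torsion_free G).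

Lemma splittingA a : A a -> a <> 1 -> U a.
Proof.
by move=> Aa a1; have := (sp_UA sp 1 Aa).2 (or_intror erefl); rewrite mulg1 => -[].
Qed.

Lemma splittingB b : B b -> ~ U b.
Proof.
by move=> Bb; rewrite -[b]mulg1 (sp_UB sp) //; exact: sp_notU1 sp.
Qed.

Lemma splitting_mul_neq1 a b : A a -> B b -> a <> 1 -> a * b <> 1.
Proof.
move=> Aa Bb a1 /eqP; rewrite mulg_eq1 => /eqP ab.
apply: (@splittingB b^-1); first exact: subgroupV (sp_subgroupB sp) Bb.
by rewrite -ab; exact: splittingA.
Qed.

Variables (al be : G).
Hypotheses (Aal : A al) (Bbe : B be) (al1 : al <> 1) (be1 : be <> 1).
Local Notation ev := (eval_seq al be).

Let letterX_neq1 l n : letter al be l ^+ n.+1 <> 1.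
Proof. by case: l => /tf. Qed.

Let eval_nseq n l : ev (nseq n l) = letter al be l ^+ n.
Proof. by elim: n => [|n IH] //=; rewrite IH -expgSr. Qed.

Let head_run (b : bool) s : exists n t, b :: s = nseq n.+1 b ++ t /\
  (t = [::] \/ exists t', t = ~~ b :: t').
Proof.
elim: s => [|c s [n [t [E H]]]]; first by exists 0%N, [::]; split => //; left.
have [->|cb] := eqVneq c b.
  by exists n.+1, t; split => //=; congr (_ :: _); rewrite E.
by exists 0%N, (c :: s); split => //; right; exists s; move: cb; case: (c) (b) => [] [].
Qed.

(** Ping-pong.  The first letter, which is the innermost factor, decides the membership in U,
    since later letters from A preserve U and 1 together, and those from B
    preserve U; the value 1 on the way would spoil this.  It does not occur: split off the
    longest initial run of one letter.  The value of the run is a nontrivial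
    power because G is torsion-free, and the rest of the word would be its inverse, an element
    that lies on the other side of U than the first letter of the rest prescribes. *)
Lemma positive_word s : s != [::] -> ev s <> 1 /\ (U (ev s) <-> head false s = true).
Proof.
have [n sn] := ubnP (size s); elim: n s sn => // n IH s /ltnSE sn s0.
have ev1 : ev s <> 1.
  case: s sn s0 => // b s sn _; have [k [t [sE tE]]] := head_run b s.
  move: sn; rewrite sE => sn.
  rewrite eval_seq_cat eval_nseq => E.
  have {E} E : ev t = letter al be b ^- k.+1.
    by apply/eqP; rewrite -mulg_eq1; apply/eqP.
  case: tE => [t0|[t' tE]].
    by move: E; rewrite t0 /= => /eqP; rewrite eq_sym invg_eq1 => /eqP /letterX_neq1.
  have tn : (size t < n)%N by apply: leq_trans sn; rewrite size_cat size_nseq addSn ltnS leq_addl.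
  have t0 : t != [::] by rewrite tE.
  have [_] := IH t tn t0; rewrite E tE; case: (b) => /= H.
    have [Hf _] := H; suff /Hf : U (al ^- k.+1) by []. apply: splittingA.
      by apply: subgroupV (sp_subgroupA sp) _; exact: subgroupX (sp_subgroupA sp) Aal.
    by apply/eqP; rewrite invg_eq1; apply/eqP => /(@letterX_neq1 true).
  apply: splittingB (proj2 H erefl); apply: subgroupV (sp_subgroupB sp) _.
  exact: subgroupX (sp_subgroupB sp) Bbe.
split => //; elim/last_ind: s sn s0 ev1 => // s l _ sn _ ev1.
move: ev1; rewrite eval_seq_rcons => ev1.
have [s0|s0] := eqVneq s [::].
  rewrite s0 /= mulg1; case: l {sn ev1} => /=; split => //.
    by move=> _; exact: splittingA.
  by move/(splittingB Bbe).
have [|es1 IHs] := IH s _ s0; first by move: sn; rewrite size_rcons.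
have -> : head false (rcons s l) = head false s by case: s s0 {sn ev1 es1 IHs}.
apply: iff_trans IHs.
case: l ev1 {sn} => /= ev1; last exact: (sp_UB sp).
have := sp_UA sp (ev s) Aal; tauto.
Qed.

Lemma positive_words_inj s t : size s = size t -> ev s = ev t -> s = t.
Proof.
elim: s t => [|b s IH] [|c t] //= [st] E.
have [_ Ub] := @positive_word (b :: s) isT; have [_ Uc] := @positive_word (c :: t) isT.
move: Ub Uc; rewrite /= E => Ub Uc.
have bc : b = c by case: (b) (c) Ub Uc => [] []; intuition.
by move: E; rewrite bc => /mulIg /(IH _ st) ->.
Qed.

End PositiveWords.

(** * Splittings of free groups *)

Section FreeBasis.
Context {G : groupType} (s : seq G) (sb : free_basis s).
Local Notation L := ('I_(size s) * bool)%type.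

Let lv (l : L) : G := if l.2 then (s`_l.1)^-1 else s`_l.1.
Let flip (l : L) : L := (l.1, ~~ l.2).
Let follows (k l : L) := ~~ ((k.1 == l.1) && (k.2 != l.2)).

Let lv_flip l : lv (flip l) = (lv l)^-1.
Proof. by case: l => i [] //=; rewrite /lv /= invgK. Qed.

Let followsE k l : follows k l = (l != flip k).
Proof.
case: k l => i b [j c]; rewrite /follows /flip /= xpair_eqE [i == j]eq_sym.
by congr (~~ (_ && _)); case: b c => [] [].
Qed.

Let exists_nf : exists nf : G -> seq L, forall g,
  [/\ sorted follows (nf g), eval_word (nf g) = g &
      forall w : seq L, sorted follows w -> eval_word w = g -> w = nf g].
Proof.
have /choice[f fP] : forall g, exists w : seq L, [/\ sorted follows w, eval_word w = g &
    forall w' : seq L, sorted follows w' -> eval_word w' = g -> w' = w].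
  move=> g; have [w [[wr wg] wu]] := sb g; exists w; split => // w' wr' wg'.
  by rewrite (wu w').
by exists f.
Qed.

Let nf := projT1 (cid exists_nf).
Let nf_sorted g : sorted follows (nf g). Proof. by have [] := projT2 (cid exists_nf) g. Qed.
Let nfK g : eval_word (nf g) = g. Proof. by have [] := projT2 (cid exists_nf) g. Qed.
Let nf_uniq w : sorted follows w -> nf (eval_word w) = w.
Proof. by move=> wr; have [_ _ H] := projT2 (cid exists_nf) (eval_word w); apply/esym/H. Qed.

Let eval_cons l (w : seq L) : @eval_word G s (l :: w) = lv l * eval_word w.
Proof. by rewrite /eval_word big_cons. Qed.

Let eval_nil : @eval_word G s [::] = 1. Proof. by rewrite /eval_word big_nil. Qed.

Let nf1 : nf 1 = [::]. Proof. by rewrite -eval_nil nf_uniq. Qed.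

Let nf_eq1 g : nf g = [::] -> g = 1. Proof. by move=> E; rewrite -(nfK g) E eval_nil. Qed.

Let nf_mul l g : nf (lv l * g) =
  if nf g is k :: w then if k == flip l then w else l :: k :: w else [:: l].
Proof.
have := nf_sorted g; have := nfK g; case: (nf g) => [<- _|k w <- kw].
  by rewrite -eval_cons nf_uniq.
case: eqVneq => [kl|kl]; last by rewrite -eval_cons nf_uniq //= followsE kl.
move: kw; rewrite eval_cons kl lv_flip mulVKg => /path_sorted kw.
by rewrite nf_uniq.
Qed.

Let Uset (P : pred L) : set G := [set g | if nf g is k :: w then P (last k w) else false].

Let Uset1 P : ~ Uset P 1. Proof. by rewrite /Uset /= nf1. Qed.

Let lv_g1 l g : lv l * g = 1 -> nf g = [:: flip l].
Proof.
move=> E; have -> : g = lv (flip l) * 1.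
  by rewrite lv_flip mulg1 (mulg1_eq E).
by rewrite nf_mul nf1.
Qed.

Let Uset_letter (P : pred L) l g :
  (P l -> P (flip l) -> (Uset P (lv l * g) \/ lv l * g = 1 <-> Uset P g \/ g = 1)) /\
  (~~ P l -> ~~ P (flip l) -> (Uset P (lv l * g) <-> Uset P g)) /\
  (P l -> ~~ P (flip l) -> (Uset P (lv l * g) <-> Uset P g \/ g = 1)).
Proof.
rewrite /Uset /= nf_mul; have T : is_true true by []; have F : ~ is_true false by [].
have lg1 : lv l * g = 1 <-> nf g = [:: flip l].
  split; first exact: lv_g1.
  by move=> E; rewrite -(nfK g) E eval_cons eval_nil mulg1 lv_flip mulgV.
have g1 : g = 1 <-> nf g = [::] by split => [->|/nf_eq1].
case E : (nf g) lg1 g1 => [|k w] lg1 g1 /=.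
  by have := proj2 g1 erefl; case: (P l); case: (P (flip l)) => /=; tauto.
have ng1 : g <> 1 by move/(proj1 g1).
case: eqVneq lg1 => [->|kl] lg1; last first.
  have nlg : lv l * g <> 1.
    by move=> /(proj1 lg1) kE; case: kE kl => -> _; rewrite eqxx.
  tauto.
case: w E lg1 g1 => [|k' w] E lg1 g1 /=.
  have lg := proj2 lg1 erefl; case: (P l); case: (P (flip l)) => /=; tauto.
have nlg : lv l * g <> 1 by move/(proj1 lg1).
tauto.
Qed.

Lemma free_basis_gen (N : set G) : subgroup N -> (forall i, (i < size s)%N -> N s`_i) ->
  forall g, N g.
Proof.
move=> sN Ns g; rewrite -(nfK g); elim: (nf g) => [|[i b] w IH].
  by rewrite eval_nil; exact: subgroup1.
rewrite eval_cons; apply: subgroupM => //; rewrite /lv /=.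
by case: b; [apply: subgroupV => //|]; exact: Ns.
Qed.

Lemma free_basis_countable : exists en : nat -> G, forall g, exists n, en n = g.
Proof.
exists (fun n => if unpickle n is Some w then @eval_word G s w else 1) => g.
by exists (pickle (nf g)); rewrite pickleK nfK.
Qed.

Lemma free_basis_neq1 i : (i < size s)%N -> s`_i <> 1.
Proof.
move=> ilt s1; have := @nf_uniq [:: (Ordinal ilt, false)] isT.
by rewrite eval_cons eval_nil mulg1 /lv /= s1 nf1.
Qed.

Let eval_cat (w w' : seq L) : @eval_word G s (w ++ w') = eval_word w * eval_word w'.
Proof. by rewrite /eval_word big_cat. Qed.

Let repeat_sorted x p n : path follows x p -> follows (last x p) x ->
  sorted follows (flatten (nseq n.+1 (x :: p))).
Proof.
move=> xp px; rewrite /= cat_path xp /=; elim: n => //= n IH.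
by rewrite px /= cat_path xp.
Qed.

(** Induction on the length of the reduced word of g.  If its last letter is not
    the inverse of its first letter, then repeating the word gives a
    nonempty reduced word for each power of g; otherwise g is conjugate to the shorter
    element obtained by removing both letters. *)
Lemma free_basis_torsion_free : torsion_free G.
Proof.
move=> g n; have [m] := ubnP (size (nf g)); elim: m g => // m IH g /ltnSE gm gn.
case E : (nf g) => [|x p]; first exact: nf_eq1.
have xp : path follows x p by have := nf_sorted g; rewrite E.
have gE : g = lv x * eval_word p by rewrite -(nfK g) E eval_cons.
have [px|px] := boolP (follows (last x p) x).
  have ev j : @eval_word G s (flatten (nseq j (x :: p))) = g ^+ j.
    elim: j => [|j IHj]; first by rewrite /= eval_nil.
    have -> : flatten (nseq j.+1 (x :: p)) = (x :: p) ++ flatten (nseq j (x :: p)) by [].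
    by rewrite eval_cat IHj eval_cons -gE expgS.
  by have := nf_uniq (repeat_sorted n xp px); rewrite ev gn nf1.
move: px; rewrite followsE negbK => /eqP xE.
case/lastP: p xE E xp gE => [|p y].
  by move=> /= xE; have := congr1 snd xE; rewrite /=; case: (x.2).
rewrite last_rcons => xE E xp gE.
pose h := @eval_word G s p.
have hE : g = lv x * h * (lv x)^-1.
  by rewrite gE -cats1 eval_cat eval_cons eval_nil mulg1 xE lv_flip invgK mulgA.
have nfh : nf h = p.
  apply: nf_uniq; move: xp; rewrite rcons_path => /andP[/path_sorted //].
suff h1 : h = 1 by rewrite hE h1 mulg1 mulgV.
apply: IH.
  rewrite nfh; apply: leq_trans gm; rewrite E /= size_rcons; exact: leqW.
have : (h ^ (lv x)^-1) ^+ n.+1 = 1 by rewrite conjgE invgK mulgA -hE.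
by rewrite -conjXg => /eqP; rewrite conjg_eq1 => /eqP.
Qed.

(** U consists of the elements whose reduced word ends in a letter selected by P.
    Multiplying by a letter on the left changes the last letter only when it
    creates or cancels a word of one letter, which explains the role of 1. *)
Lemma free_basis_half_tree (P : nat -> bool -> bool) : exists U : set G,
  ~ U 1 /\ forall i, (i < size s)%N -> forall g,
  [/\ P i false -> P i true -> (U (s`_i * g) \/ s`_i * g = 1 <-> U g \/ g = 1),
      ~~ P i false -> ~~ P i true -> (U (s`_i * g) <-> U g) &
      P i false -> ~~ P i true -> (U (s`_i * g) <-> U g \/ g = 1)].
Proof.
exists (Uset (fun l => P l.1 l.2)); split=> [|i ilt g]; first exact: Uset1.
by have [? [? ?]] := Uset_letter (fun l => P l.1 l.2) (Ordinal ilt, false) g.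
Qed.
End FreeBasis.

Lemma mul_invariant_subgroup (G : groupType) (V : set G) :
  subgroup [set a | forall g, V (a * g) <-> V g].
Proof.
split=> [g|a b /= aV bV g]; first by rewrite mul1g.
rewrite -mulgA; apply: iff_trans (aV _) _; apply: iff_sym.
by apply: iff_trans (bV _); rewrite mulVKg.
Qed.

(** U consists of the reduced words that end in a letter of s or in its inverse. *)
Lemma splitting_free_product (G : groupType) (s t : seq G) :
  free_basis (s ++ t) -> exists U, splitting (gen [set` s]) (gen [set` t]) set0 U.
Proof.
move=> stb; have [U [U1 UP]] := free_basis_half_tree stb (fun i _ => (i < size s)%N).
have sA := subgroup_gen [set` s]; have sB := subgroup_gen [set` t].
exists U; split => //.
- move=> a g sa; move: a sa g.
  apply: gen_min (mul_invariant_subgroup (fun g => U g \/ g = 1)) _ => x /= xs g.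
  have ilt := xs; rewrite -index_mem in ilt.
  have [|H _ _] := UP (index x s) _ g; first by rewrite size_cat ltn_addr.
  by move: H; rewrite nth_cat ilt nth_index //; apply.
- move=> b g tb; move: b tb g.
  apply: gen_min (mul_invariant_subgroup U) _ => x /= xs g.
  have ilt := xs; rewrite -index_mem in ilt.
  have [|_ H _] := UP (size s + index x t)%N _ g; first by rewrite size_cat ltn_add2l.
  move: H; rewrite nth_cat ltnNge leq_addr /= addKn nth_index //; exact.
- move=> N sN AN BN _; apply: (free_basis_gen stb) => // i; rewrite size_cat nth_cat => ilt.
  case: ifPn => is_; first by apply: AN; apply: sub_gen; exact: (mem_nth 1 is_).
  apply: BN; apply: sub_gen; apply: (mem_nth 1); by rewrite ltn_subLR // leqNgt.
Qed.

(** U consists of the reduced words that end in a letter of s, in its inverse or in t.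
    The asymmetry between t and t^-1 is what makes t take U and 1 onto U. *)
Lemma splitting_HNN (G : groupType) (s : seq G) (t : G) :
  free_basis (rcons s t) -> let A := gen [set` s] in
  exists U, splitting A [set b | A (t^-1 * b * t)] [set h | A (t^-1 * h)] U.
Proof.
move=> stb A; have [U [U1 UP]] := free_basis_half_tree stb (fun i b => (i < size s)%N || ~~ b).
have sA : subgroup A := subgroup_gen [set` s].
have UA a g : A a -> (U (a * g) \/ a * g = 1 <-> U g \/ g = 1).
  move=> sa; move: a sa g.
  apply: gen_min (mul_invariant_subgroup (fun g => U g \/ g = 1)) _ => x /= xs g.
  have ilt := xs; rewrite -index_mem in ilt.
  have [|H _ _] := UP (index x s) _ g; first by rewrite size_rcons ltnW.
  by move: H; rewrite nth_rcons ilt nth_index //; apply.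
have Ut g : U (t * g) <-> U g \/ g = 1.
  have [|_ _ H] := UP (size s) _ g; first by rewrite size_rcons.
  by move: H; rewrite nth_rcons ltnn eqxx; apply.
have tK h : h = t * (t^-1 * h) by rewrite mulVKg.
exists U; split => //.
- split=> [|b c /= bA cA]; first by rewrite /= mulg1 mulVg; exact: subgroup1.
  have -> : t^-1 * (b / c) * t = (t^-1 * b * t) / (t^-1 * c * t) by rewrite !invgM invgK !mulgA mulgK.
  exact: (proj2 sA).
- move=> b g /= bA; have -> : b * g = t * ((t^-1 * b * t) * (t^-1 * g)).
    by rewrite !mulgA mulgV mul1g mulgK.
  apply: iff_trans (Ut _) _; apply: iff_trans (UA _ _ bA) _; apply: iff_sym.
  by apply: iff_trans (Ut _); rewrite -tK.
- move=> h g /= hA; rewrite [h]tK -mulgA; apply: iff_trans (Ut _) _; exact: UA.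
- by move=> h a /= hA aA; rewrite mulgA; exact: subgroupM sA hA aA.
- by move=> b h /= bA hA; have := subgroupM sA bA hA; rewrite !mulgA mulgK.
- move=> h k /= hA kA; have := subgroupM sA (subgroupV sA hA) kA.
  by rewrite invgM invgK -mulgA mulVKg.
- by move=> h k /= hA kA; have := (proj2 sA) _ _ hA kA; rewrite invgM invgK !mulgA.
- move=> N sN AN BN CN; apply: (free_basis_gen stb) => // i; rewrite size_rcons nth_rcons ltnS => ilt.
  case: ifPn => is_; first by apply: AN; rewrite /A; apply: sub_gen; exact: (mem_nth 1 is_).
  rewrite eqn_leq ilt leqNgt is_; apply: CN; rewrite /= mulVg; exact: subgroup1.
Qed.

(** * Replacing attachments by the steps of an element *)

Section Walks.
Context {X : Type} (E1 E2 : X -> X -> Prop).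

(** The parity b of the steps of E1 is a parameter so that a piece of a walk is again
    a walk, wherever it begins. *)
Definition walk (b : bool) (m : nat) (y : nat -> X) : Prop :=
  forall i, (i < m)%N -> y i <> y i.+1 /\
    if odd i == b then E1 (y i) (y i.+1) else E2 (y i) (y i.+1).

Lemma walk_shift b m y p n : walk b m y -> (p + n <= m)%N ->
  walk (b (+) odd p) n (fun i => y (p + i)%N).
Proof.
move=> yw pnm i iltn; have [|ne st] := yw (p + i)%N; first lia.
rewrite addnS; split => //; move: st; rewrite oddD.
by case: (odd p) (odd i) (b) => [] [] [].
Qed.

(** A shortest closed walk never meets the same class of E1 in two different steps:
    if steps p < q of E1 lie in one class, then the piece from p + 1 to q, closed by
    one step inside that class, is shorter.  It is closed and alternating because the
    two steps have the same parity. *)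
Lemma no_closed_walk :
  (forall b m y, (0 < m)%N -> walk b m y -> y 0%N = y m ->
    (forall p q, (p < q)%N -> (q < m)%N -> odd p = b -> odd q = b ->
       ~ E1 (y q) (y p.+1)) -> False) ->
  forall b m y, (0 < m)%N -> walk b m y -> y 0%N <> y m.
Proof.
move=> H b m; have [k] := ubnP m; elim: k b m => // k IH b m /ltnSE mk y m0 yw ym.
have simple p q : (p < q)%N -> (q <= m)%N -> (q - p < m)%N -> y p <> y q.
  move=> pq qm sm; have := IH _ (q - p)%N _ (fun i => y (p + i)%N) _
    (walk_shift (n := (q - p)%N) yw _).
  rewrite addn0 subnKC; last exact: ltnW.
  by apply; lia.
apply: (H b m y) => // p q pq qm op oq E.
have pq2 : (p.+1 < q)%N.
  by rewrite ltn_neqAle pq andbT; apply/eqP => pqE; move: oq; rewrite -pqE /= op; case: (b).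
pose z i := if (i < q - p.+1 + 1)%N then y (p.+1 + i)%N else y p.+1.
suff zw : walk (b (+) odd p.+1) (q - p.+1).+1 z.
  have := IH _ _ _ z _ zw; rewrite /z /= addn1 ltnn addn0; apply => //; lia.
move=> i iq; rewrite /z addn1 iq.
have [ilt|ige] := ltnP i.+1 (q - p.+1).+1.
  have [|ne st] := yw (p.+1 + i)%N; first lia.
  rewrite addnS; split => //; move: st; rewrite oddD.
  by case: (odd p.+1) (odd i) (b) => [] [] [].
have -> : i = (q - p.+1)%N by lia.
rewrite subnKC; last exact: ltnW.
split; first by apply/nesym; apply: simple => //; lia.
rewrite oddB; last exact: ltnW.
by rewrite oq /= op; case: (b).
Qed.

End Walks.

Definition rank_lt (p q : nat * nat) : bool :=
  (p.1 < q.1)%N || ((p.1 == q.1) && (p.2 < q.2)%N).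

Lemma rank_lt_trans p q r : rank_lt p q -> rank_lt q r -> rank_lt p r.
Proof.
move: p q r => [p1 p2] [q1 q2] [r1 r2]; rewrite /rank_lt /=.
case/orP=> [pq|/andP[/eqP -> pq]]; case/orP=> [qr|/andP[/eqP <- qr]];
  by rewrite ?eqxx ?(ltn_trans pq qr) ?pq ?qr ?orbT.
Qed.

Lemma rank_ltxx p : rank_lt p p = false.
Proof. by rewrite /rank_lt !ltnn andbF. Qed.

Lemma rank_max (T : eqType) (rk : T -> nat * nat) (s : seq T) x : x \in s ->
  exists2 z, z \in s & forall u, u \in s -> ~~ rank_lt (rk z) (rk u).
Proof.
elim: s x => // t s IH x _; case: s IH => [_|t' s IH].
  by exists t; rewrite ?inE // => u; rewrite inE => /eqP ->; rewrite rank_ltxx.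
have [z zs zmax] := IH t' (mem_head _ _).
have [zt|zt] := boolP (rank_lt (rk z) (rk t)).
  exists t; rewrite ?mem_head // => u; rewrite in_cons => /orP[/eqP ->|/zmax /negP nzu].
    by rewrite rank_ltxx.
  by apply/negP => tu; apply: nzu; exact: rank_lt_trans zt tu.
exists z; first by rewrite in_cons zs orbT.
by move=> u; rewrite in_cons => /orP[/eqP ->//|/zmax].
Qed.

Section Cells.
Context (G : groupType) d (X : measurableType d) (a : G -> X -> X).
Hypotheses (a1 : forall x, a 1 x = x) (aM : forall g h x, a (g * h) x = a g (a h x))
  (a_free : free_action a).
Context (A B C U : set G) (sp : splitting A B C U) (tf : torsion_free G).
Variables (v w : G) (Av : A v) (Bw : B w) (v1 : v <> 1) (w1 : w <> 1).
Variables (X0 D : set X) (rk : X -> nat * nat).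
Hypothesis X0_inv : invariant_set a X0.

Let c := v * w.
Let dx x := `[< D x >].
Let f x := if dx x then a v^-1 x else a w x.
Hypothesis rk_f : forall x, X0 x -> rank_lt (rk x) (rk (f x)).

Let aK g x : a g^-1 (a g x) = x. Proof. by rewrite -aM mulVg a1. Qed.
Let aKV g x : a g (a g^-1 x) = x. Proof. by rewrite -aM mulgV a1. Qed.
Let a_inj g x y : a g x = a g y -> x = y. Proof. by move=> E; rewrite -(aK g x) E aK. Qed.
Let a_eq g h x : a g x = a h x -> g = h.
Proof.
by move=> E; apply: (mulgI h^-1); rewrite mulVg; apply: (a_free (x := x)); rewrite aM E aK.
Qed.

(** Every point keeps one of its two attachments to vertices of the tree: points of D
    keep the B-vertex and the others keep the A-vertex.  With true standing for
    membership in D, link p q consists of the h for which x and h x keep the same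
    vertex when x is of kind p and h x is of kind q. *)
Definition link (p q : bool) : set G :=
  match p, q with
  | false, false => A | true, true => B
  | false, true => C | true, false => [set h | C h^-1]
  end.

Lemma link1 p : link p p 1.
Proof. by case: p; apply: subgroup1; [exact: sp_subgroupB sp|exact: sp_subgroupA sp]. Qed.

Lemma linkV p q h : link p q h -> link q p h^-1.
Proof.
case: p; case: q => /=; rewrite ?invgK //; apply: subgroupV;
  [exact: sp_subgroupB sp|exact: sp_subgroupA sp].
Qed.

Lemma linkM p q r h k : link p q h -> link q r k -> link p r (k * h).
Proof.
have sA := sp_subgroupA sp; have sB := sp_subgroupB sp.
case: p; case: q; case: r => /= hL kL.
- exact: subgroupM sB kL hL.
- by rewrite invgM; apply: (sp_BC sp) => //; exact: subgroupV.
- by rewrite -[h]invgK; exact: (sp_CCV sp).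
- by rewrite invgM; apply: (sp_CA sp) => //; exact: subgroupV.
- exact: (sp_BC sp).
- by rewrite -[k]invgK; exact: (sp_CVC sp).
- exact: (sp_CA sp).
- exact: subgroupM sA kL hL.
Qed.

(** The complementary relation: two points keep the same vertex. *)
Definition blob x y := exists2 h, link (dx x) (dx y) h & a h x = y.

Lemma blob_refl x : blob x x. Proof. by exists 1; [exact: link1|]. Qed.
Lemma blob_sym x y : blob x y -> blob y x.
Proof. by move=> [h hL hE]; exists h^-1; [exact: linkV hL|rewrite -hE; exact: aK]. Qed.
Lemma blob_trans x y z : blob x y -> blob y z -> blob x z.
Proof.
by move=> [h hL hE] [k kL kE]; exists (k * h); [exact: linkM hL kL|rewrite aM hE].
Qed.

Section Generation.
Variable E : X -> X -> Prop.
Hypotheses (Esym : forall x y, E x y -> E y x)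
  (Etrans : forall x y z, E x y -> E y z -> E x z)
  (Erefl : forall x, X0 x -> E x x)
  (Ec : forall x, X0 x -> E x (a c x))
  (Eblob : forall x y, X0 x -> blob x y -> E x y).

(** A point is ranked above its preimages under f, and ranks are well-founded. *)
Let ind (P : X -> Prop) : (forall z, X0 z ->
   (forall y, X0 y -> f y = z -> P y) -> P z) -> forall z, X0 z -> P z.
Proof.
move=> H z; move E1 : (rk z).1 => n; have := leqnn n; rewrite -{1}E1 => {E1}.
elim/ltn_ind: n z => n IHn z.
move E2 : (rk z).2 => m; have := leqnn m; rewrite -{1}E2 => {E2}.
elim/ltn_ind: m z => m IHm z zm zn X0z; apply: H => // y X0y yz.
have := rk_f X0y; rewrite yz => /orP[lt1|/andP[/eqP eq1 lt2]].
  by apply: (IHn (rk y).1) => //; exact: leq_trans lt1 zn.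
by apply: (IHm (rk y).2) => //; [exact: leq_trans lt2 zm|rewrite eq1].
Qed.

Let f_v z : dx (a v z) -> f (a v z) = z. Proof. by rewrite /f => ->; exact: aK. Qed.
Let f_wV z : ~~ dx (a w^-1 z) -> f (a w^-1 z) = z.
Proof. by rewrite /f => /negbTE ->; exact: aKV. Qed.

Let cell z : X0 z -> E (a w^-1 z) (a v z).
Proof.
move=> X0z; have := Ec (X0_inv w^-1 X0z); by rewrite /c aM aKV.
Qed.

Let blobAB p q h z : X0 z -> link p q h -> dx z = p -> dx (a h z) = q -> E z (a h z).
Proof. by move=> X0z hL zp zq; apply: Eblob => //; exists h => //; rewrite zp zq. Qed.

(** The lost attachment of z is recovered from the triangle w^-1 z, z, v z, whose
    side from w^-1 z to v z is a step of c.  A point z of D goes to w^-1 z by B,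
    to v z by c, and has then made a move by A.  A corner
    that does not keep the vertex needed for its side is a preimage of z under f,
    and induction replaces it by a point that keeps this vertex. *)
Let claim z : X0 z ->
  if dx z then exists2 h, A h & ~~ dx (a h z) /\ E z (a h z)
  else exists2 h, B h & dx (a h z) /\ E z (a h z).
Proof.
have BwV : B w^-1 by exact: subgroupV (sp_subgroupB sp) Bw.
have mA := subgroupM (sp_subgroupA sp); have mB := subgroupM (sp_subgroupB sp).
move: z; apply: ind => z X0z IH.
have X0v := X0_inv v X0z; have X0w := X0_inv w^-1 X0z.
case: ifPn => dz.
  have zw : E z (a w^-1 z).
    have [dw|dw] := boolP (dx (a w^-1 z)).
      exact: (@blobAB true true).
    have := IH _ X0w (f_wV dw); rewrite (negbTE dw) => -[h Bh [dh Eh]].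
    apply: Etrans (Esym Eh); rewrite -aM.
    by apply: (@blobAB true true) => //; [exact: mB|rewrite aM].
  have zv := Etrans zw (cell X0z).
  have [dv|dv] := boolP (dx (a v z)); last by exists v.
  have := IH _ X0v (f_v dv); rewrite dv => -[h Ah [dh Eh]].
  exists (h * v); first exact: mA.
  by rewrite aM; split => //; exact: Etrans zv Eh.
have zv : E z (a v z).
  have [dv|dv] := boolP (dx (a v z)); last first.
    by apply: (@blobAB false false) => //; exact: negbTE.
  have := IH _ X0v (f_v dv); rewrite dv => -[h Ah [dh Eh]].
  apply: Etrans (Esym Eh); rewrite -aM.
  by apply: (@blobAB false false) => //; [exact: mA|exact: negbTE|rewrite aM; exact: negbTE].
have zw := Etrans zv (Esym (cell X0z)).
have [dw|dw] := boolP (dx (a w^-1 z)); first by exists w^-1.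
have := IH _ X0w (f_wV dw); rewrite (negbTE dw) => -[h Bh [dh Eh]].
exists (h * w^-1); first exact: mB.
by rewrite aM; split => //; exact: Etrans zw Eh.
Qed.

Let toA x : X0 x -> exists2 h, A h & ~~ dx (a h x) /\ E x (a h x).
Proof.
move=> X0x; have := claim X0x; case: ifPn => // dxx _.
exists 1; first exact: subgroup1 (sp_subgroupA sp).
by rewrite a1; split => //; exact: Erefl.
Qed.

Let toB x : X0 x -> exists2 h, B h & dx (a h x) /\ E x (a h x).
Proof.
move=> X0x; have := claim X0x; case: ifPn => // dxx _.
exists 1; first exact: subgroup1 (sp_subgroupB sp).
by rewrite a1; split => //; exact: Erefl.
Qed.

(** Each point is related to a point keeping its A-vertex and to a point keeping its
    B-vertex; a generator of G in A, B or C then acts inside one vertex. *)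
Lemma cells_generate g x : X0 x -> E x (a g x).
Proof.
have joined p q x' h g' y' : X0 x' -> X0 y' -> a g' x' = y' ->
    (exists2 k, link p p k & dx (a k x') = p /\ E x' (a k x')) ->
    (exists2 k, link q q k & dx (a k y') = q /\ E y' (a k y')) ->
    link p q h -> g' = h -> E x' y'.
  move=> X0x X0y <- [k kL [dk Ek]] [l lL [dl El]] hL gE.
  apply: Etrans Ek _; apply: Etrans (Esym El); rewrite gE in dl *.
  have -> : a l (a h x') = a (l * h * k^-1) (a k x') by rewrite !aM aK.
  apply: (@blobAB p q) => //; first exact: X0_inv.
    exact: linkM (linkV kL) (linkM hL lL).
  by rewrite !aM aK.
pose N : set G := [set g | forall x, X0 x -> E x (a g x)].
suff : N g by apply.
have nA y : X0 y -> exists2 k, link false false k & dx (a k y) = false /\ E y (a k y).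
  by move=> /toA[k kA [/negbTE ? ?]]; exists k.
have nB y : X0 y -> exists2 k, link true true k & dx (a k y) = true /\ E y (a k y).
  by move=> /toB[k kA [? ?]]; exists k.
apply: (sp_gen sp); last 1 first.
- move=> h hL y X0y; apply: (@joined false true _ h h) => //; [exact: X0_inv|exact: nA|exact/nB/X0_inv].
- split=> [y X0y|g' h gN hN y X0y]; first by rewrite a1; exact: Erefl.
  rewrite aM; apply: Etrans (gN _ (X0_inv _ X0y)).
  by apply: Esym; have := hN _ (X0_inv h^-1 X0y); rewrite aKV.
- move=> h hL y X0y; apply: (@joined false false _ h h) => //; [exact: X0_inv|exact: nA|exact/nA/X0_inv].
- move=> h hL y X0y; apply: (@joined true true _ h h) => //; [exact: X0_inv|exact: nB|exact/nB/X0_inv].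
Qed.

End Generation.

(** The lost attachment of z cuts the tree in two.  The side of the A-vertex contains
    z itself exactly when z keeps the A-vertex. *)
Let V z : set G := if dx z then U else [set g | U g \/ g = 1].
Definition side z y := exists2 g, V z g & a g z = y.

Let sideP z g : side z (a g z) <-> V z g.
Proof. by split=> [[h hV /a_eq <-]|gV]; [|exists g]. Qed.

Let dxN z g : dx z != dx (a g z) -> g <> 1.
Proof. by move=> H g1; move: H; rewrite g1 a1 eqxx. Qed.

(** A vertex is entirely on one side of the cut at z, except for z itself, which
    is cut off from the vertex that it does not keep. *)
Let side_blob_half z x y : blob x y -> side z x -> side z y.
Proof.
move=> [h hL hE] [g gV gE]; exists (h * g); last by rewrite aM gE hE.
have xE : dx x = dx (a g z) by rewrite gE.
have yE : dx y = dx (a (h * g) z) by rewrite aM gE hE.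
have g1 := @dxN z g; have hg1 := @dxN z (h * g).
move: hL gV; rewrite /link /V; rewrite -xE in g1; rewrite -yE in hg1.
case: (dx z) (dx x) (dx y) g1 hg1 => [] [] [] /= g1 hg1 hL gU.
- exact/(sp_UB sp).
- have := sp_UC sp (h * g) hL; rewrite mulKg => H; have [//|hgE] := proj1 H gU.
  by case: hg1.
- by apply/(sp_UC sp) => //; left.
- have [|//|hgE] := proj2 (sp_UA sp g hL); first by left.
  by case: hg1.
- left; apply/(sp_UB sp) => //; case: gU => // gE'; by case: g1.
- have := sp_UC sp (h * g) hL; rewrite mulKg => H; apply/H.
  by case: gU => // gE'; case: g1.
- by left; apply/(sp_UC sp).
- exact/(sp_UA sp).
Qed.

Lemma side_blob z x y : blob x y -> (side z x <-> side z y).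
Proof. by move=> xy; split; apply: side_blob_half => //; exact: blob_sym. Qed.

Let sideE z x : (side z x <-> side z (a c x)) \/ exists2 g, x = a g z &
  (side z x <-> V z g) /\ (side z (a c x) <-> V z (c * g)).
Proof.
have [[g gx]|nx] := pselect (exists g, x = a g z).
  by right; exists g; rewrite // gx -aM; split; exact: sideP.
left; split=> [[g _ gx]|[g _ gx]]; case: nx; first by exists g.
by exists (c^-1 * g); rewrite aM gx aK.
Qed.

(** The step from x to c x moves inside a B-vertex from x to u = w x, and then inside
    an A-vertex from u to v u.  It can cross the cut at z only by
    passing through z at the lost vertex: u = z, or v u = z with z in D, or x = z
    with z off D; the last two cases say u = f z. *)
Lemma side_other z x : a w x <> z -> a w x <> f z -> (side z (a c x) <-> side z x).
Proof.
case: (sideE z x) => [E _ _|[g xE [Ex Ec]] wz wf]; first exact: iff_sym.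
apply: iff_trans Ec _; apply: iff_trans (iff_sym Ex).
have wg1 : w * g <> 1 by move=> wg; apply: wz; rewrite xE -aM wg a1.
have UB := sp_UB sp g Bw; have UA := sp_UA sp (w * g) Av.
move: wf; rewrite /f /V /c -mulgA; case: (dx z) => wf.
  have vwg1 : v * (w * g) <> 1.
    by move=> E; apply: wf; rewrite xE -aM -[w * g](mulKg v) E mulg1.
  by rewrite /=; tauto.
have g1 : g <> 1 by move=> E; apply: wf; rewrite xE E a1.
by rewrite /=; tauto.
Qed.

Lemma side_cross z x : a w x = z -> ~ side z x /\ side z (a c x).
Proof.
move=> wx; have xE : x = a w^-1 z by rewrite -wx aK.
have cxE : a c x = a v z by rewrite aM wx.
have nU : ~ U w^-1.
  by apply: (splittingB sp); exact: subgroupV (sp_subgroupB sp) Bw.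
have vU : U v by exact: (splittingA sp).
split.
  rewrite xE => /sideP; rewrite /V; case: (dx z) => //= -[//|/eqP].
  by rewrite invg_eq1 => /eqP.
by rewrite cxE; apply/sideP; rewrite /V; case: (dx z) => //=; left.
Qed.

Let cX_neq1 k : (0 < k)%N -> c ^+ k <> 1.
Proof. by case: k => // k _ /tf; exact: (splitting_mul_neq1 sp). Qed.

(** The middle corners of the triangles over the first k steps of c from x. *)
Let crossed (x : X) (k : nat) := [seq a w (a (c ^+ j) x) | j <- iota 0 k].

Let side_line z x k : z \notin crossed x k -> f z \notin crossed x k ->
  (side z (a (c ^+ k) x) <-> side z x).
Proof.
elim: k => [|k IH]; first by rewrite expg0 a1.
rewrite /crossed -addn1 iotaD map_cat !mem_cat !negb_or /= !andbT add0n addn1.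
move=> /andP[/IH + /eqP zk] /andP[+ /eqP fk] => /[apply].
by apply: iff_trans; rewrite expgS aM; apply: side_other; apply/nesym.
Qed.

Let crossed_once z x k : z \in crossed x k -> f z \notin crossed x k ->
  ~ (side z (a (c ^+ k) x) <-> side z x).
Proof.
case/mapP => i; rewrite mem_iota /= add0n => ik zE fz.
have sub_crossed p q u : (p + q <= k)%N -> u \in crossed (a (c ^+ p) x) q -> u \in crossed x k.
  move=> pqk /mapP[j]; rewrite mem_iota add0n => /andP[_ jq] ->.
  apply/mapP; exists (j + p)%N; last by rewrite expgnDr aM.
  by rewrite mem_iota add0n /=; lia.
have z_uniq j : (j < k)%N -> z = a w (a (c ^+ j) x) -> j = i.
  move=> jk; rewrite zE => /a_inj /a_eq E; apply/eqP; rewrite eqn_leq; apply/andP.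
  by split; rewrite leqNgt; apply/negP => lt;
    [apply: (@cX_neq1 (j - i))|apply: (@cX_neq1 (i - j))];
    rewrite ?subn_gt0 // expgnFr ?(ltnW lt) // E mulgV.
have [n1 n2] := @side_cross z (a (c ^+ i) x) (esym zE).
have H1 : side z (a (c ^+ i) x) <-> side z x.
  apply: side_line; last first.
    by apply: contra fz => fi; apply: (sub_crossed 0%N i); [lia|rewrite expg0 a1].
  apply/negP => /mapP[j]; rewrite mem_iota add0n => /andP[_ ji] E.
  have jk : (j < k)%N by lia.
  by have := z_uniq j jk E; lia.
have H2 : side z (a (c ^+ k) x) <-> side z (a (c ^+ i.+1) x).
  have -> : a (c ^+ k) x = a (c ^+ (k - i.+1)) (a (c ^+ i.+1) x).
    by rewrite -aM -expgnDr subnK.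
  apply: side_line.
    apply/negP => /mapP[j]; rewrite mem_iota add0n -(aM (c ^+ j)) -expgnDr => /andP[_ jk] E.
    have jk' : (j + i.+1 < k)%N by lia.
    by have := z_uniq _ jk' E; lia.
  by apply: contra fz; apply: sub_crossed; lia.
move: n2; rewrite -aM -expgS; tauto.
Qed.

Definition line x y := exists2 g, gen [set c] g & a g x = y.

Let lineP x y : line x y -> exists (k : nat) (dir : bool),
  if dir then y = a (c ^+ k) x else x = a (c ^+ k) y.
Proof.
move=> [g /gen1P[k [->|->]] <-]; exists k; [by exists true|exists false].
by rewrite aKV.
Qed.

Let line_sym x y : line x y -> line y x.
Proof.
by move=> [g gc gE]; exists g^-1; [exact: subgroupV (subgroup_gen _) gc|rewrite -gE aK].
Qed.
Let line_trans x y z : line x y -> line y z -> line x z.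
Proof.
move=> [g gc gE] [h hc hE]; exists (h * g); last by rewrite aM gE.
exact: subgroupM (subgroup_gen _) hc gc.
Qed.

Let line_pow k x : line x (a (c ^+ k) x).
Proof. by exists (c ^+ k) => //; apply: subgroupX (subgroup_gen _) _; exact: sub_gen. Qed.

(** In a shortest closed walk the steps of the first kind run along distinct lines of
    c, so a triangle lies over at most one of them.  If one lies over a step of
    the walk, the walk crosses the cut at its middle corner z there, and must
    cross it again; since the complementary relation never crosses it, the
    triangle of f z lies over some step too.  So the middle corners are
    closed under f, but they are finitely many and f increases the rank. *)
Lemma cells_free b m y : (0 < m)%N ->
  walk (fun x y => X0 x /\ line x y) (fun x y => X0 x /\ blob x y) b m y ->
  y 0%N <> y m.
Proof.
apply: no_closed_walk => {b m y} b m y m0 yw ym distinct.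
have X0y i : (i < m)%N -> X0 (y i).
  by move=> /yw[_]; case: ifP => _ [].
have /choice[kd kdP] : forall i, exists kd : nat * bool, (i < m)%N -> odd i = b ->
    if kd.2 then y i.+1 = a (c ^+ kd.1) (y i) else y i = a (c ^+ kd.1) (y i.+1).
  move=> i; have [im|im] := ltnP i m; last by exists (0%N, true) => ?; lia.
  have [ib|ib] := eqVneq (odd i) b; last by exists (0%N, true) => _ /eqP; rewrite (negbTE ib).
  by have [_] := yw _ im; rewrite ib eqxx => -[_ /lineP[k [dir H]]]; exists (k, dir).
pose base i := if (kd i).2 then y i else y i.+1.
pose cells i := crossed (base i) (kd i).1.
have base_line i : (i < m)%N -> odd i = b -> line (base i) (y i) /\ line (base i) (y i.+1).
  move=> im ib; have := kdP i im ib; rewrite /base.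
  by case: (kd i).2 => /= E; split; rewrite ?E; try exact: (line_pow 0); try exact: line_pow;
    exists 1; rewrite ?a1 //; exact: subgroup1 (subgroup_gen _).
have X0base i : (i < m)%N -> odd i = b -> X0 (base i).
  move=> im ib; have := X0y i im; have := kdP i im ib; rewrite /base.
  case: (kd i).2 => //= -> X0i; rewrite -(aK (c ^+ (kd i).1) (y i.+1)); exact: X0_inv.
have cellsX0 i z : (i < m)%N -> odd i = b -> z \in cells i -> X0 z.
  by move=> im ib /mapP[j _ ->]; apply: X0_inv; apply: X0_inv; exact: X0base.
have cells_line i z : (i < m)%N -> odd i = b -> z \in cells i ->
    line (y i) (a w^-1 z) /\ line (y i.+1) (a w^-1 z).
  move=> im ib /mapP[j _ ->]; rewrite aK; have [l1 l2] := base_line i im ib.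
  by split; apply: line_trans (line_pow j _); exact: line_sym.
pose s := flatten [seq cells i | i <- [seq i <- iota 0 m | odd i == b]].
have sP z : z \in s <-> exists i, [/\ (i < m)%N, odd i = b & z \in cells i].
  split=> [/flatten_mapP[i]|[i [im ib zi]]].
    by rewrite mem_filter mem_iota add0n => /andP[/eqP ib im] zi; exists i.
  by apply/flatten_mapP; exists i => //; rewrite mem_filter mem_iota add0n ib eqxx.
have bm : (b < m)%N.
  have [m1|m1] := eqVneq m 1%N; last by case: (b); lia.
  by move: ym; rewrite m1 => ym; have [] := yw 0%N m0.
have ob : odd b = b by case: (b).
have ws : a w (base b) \in s.
  apply/sP; exists b; split => //; apply/mapP; exists 0%N; last by rewrite expg0 a1.
  rewrite mem_iota add0n lt0n; apply/eqP => k0.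
  have [ne _] := yw _ bm; apply: ne.
  by have := kdP _ bm ob; rewrite k0 expg0 !a1; case: (kd b).2.
have [z /sP[p [pm pb zp]] zmax] := rank_max rk ws.
have fz : f z \notin s.
  by apply/negP => /zmax; rewrite rk_f //; exact: cellsX0 zp.
have cellsNf i : (i < m)%N -> odd i = b -> f z \notin cells i.
  by move=> im ib; apply: contra fz => fi; apply/sP; exists i.
have step i : (i < m)%N -> i <> p -> (side z (y i.+1) <-> side z (y i)).
  move=> im ip; have [_] := yw i im; case: eqVneq => [ib _|_ [_ /side_blob H]]; last exact: iff_sym.
  have zi : z \notin cells i.
    apply/negP => zi; have [li li1] := cells_line i z im ib zi.
    have [lp lp1] := cells_line p z pm pb zp.
    have [lt|lt|//] := ltngtP i p.
      apply: (distinct i p) => //; split; first exact: X0y.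
      by apply: line_trans lp _; exact: line_sym.
    apply: (distinct p i) => //; split; first exact: X0y.
    by apply: line_trans li _; exact: line_sym.
  have := side_line zi (cellsNf i im ib); have := kdP i im ib; rewrite /base.
  by case: (kd i).2 => /= <-; tauto.
have pre i : (i <= p)%N -> (side z (y i) <-> side z (y 0%N)).
  elim: i => // i IH ip; apply: iff_trans (IH (ltnW ip)); apply: step; first exact: ltn_trans ip pm.
  by move=> E; move: ip; rewrite E ltnn.
have post i : (p < i)%N -> (i <= m)%N -> (side z (y i) <-> side z (y p.+1)).
  elim: i => // i IH; rewrite ltnS leq_eqVlt => /orP[/eqP <- //|pi] im.
  apply: iff_trans (IH pi (ltnW im)); apply: step => // E; move: pi; rewrite E ltnn //.
have := crossed_once zp (cellsNf p pm pb); have := kdP p pm pb.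
have := pre p (leqnn p); have := post m pm (leqnn m); rewrite -ym /base.
by case: (kd p).2 => ? ? /= <-; tauto.
Qed.
End Cells.

(** * Finite contents *)

Section Content.
Local Open Scope ring_scope.
Context (R : realType) d (X : measurableType d).
Implicit Types (th : set X -> R) (A B : set X).

(** A finite measure, with real values and with countable additivity replaced by
    continuity along decreasing sequences with empty intersection.  In this form
    the finite sums and restricted pullbacks formed below need no extended reals. *)
Definition finite_content th : Prop :=
  [/\ forall A, measurable A -> 0 <= th A,
      forall A B, measurable A -> measurable B ->
        th A = th (A `&` B) + th (A `\` B) &
      forall F : nat -> set X, (forall n, measurable (F n)) ->
        (forall n, F n.+1 `<=` F n) -> (forall x, exists n, ~ F n x) ->
        forall e : R, 0 < e -> exists n, th (F n) <= e].

Section Basic.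
Context (th : set X -> R) (th_fc : finite_content th).

Lemma content_ge0 A : measurable A -> 0 <= th A.
Proof. by case: th_fc => + _ _; apply. Qed.

Lemma contentI A B : measurable A -> measurable B ->
  th A = th (A `&` B) + th (A `\` B).
Proof. by case: th_fc => _ + _; apply. Qed.

Lemma content0 : th set0 = 0.
Proof.
have := contentI (@measurable0 _ X) (@measurable0 _ X).
by rewrite setI0 setD0 => /eqP; rewrite -subr_eq0 opprD addrA subrr sub0r oppr_eq0 => /eqP.
Qed.

Lemma le_content A B : measurable A -> measurable B -> A `<=` B -> th A <= th B.
Proof.
move=> mA mB AB; rewrite (contentI mB mA) (setIidr AB) lerDl.
by apply: content_ge0; exact: measurableD.
Qed.

Lemma contentU A B : measurable A -> measurable B ->
  th (A `|` B) <= th A + th B.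
Proof.
move=> mA mB; rewrite (contentI (measurableU _ _ mA mB) mA) setUK lerD2l.
apply: le_content => //; first by apply: measurableD => //; exact: measurableU.
by move=> x [[]].
Qed.

Lemma content_vanish (F : nat -> set X) : (forall n, measurable (F n)) ->
  (forall n, F n.+1 `<=` F n) -> (forall x, exists n, ~ F n x) ->
  forall e : R, 0 < e -> exists n, th (F n) <= e.
Proof. by case: th_fc => _ _ H; exact: H. Qed.

Section Fibres.
Context (V : finType) (lab : X -> V).
Hypothesis mlab : forall v, measurable [set x | lab x = v].

Lemma measurable_labels (q : pred V) : measurable [set x | q (lab x)].
Proof.
have -> : [set x | q (lab x)] = \bigcup_(v in [set v | q v]) [set x | lab x = v].
  by apply/seteqP; split => [x qx|x [v qv /= ->]//]; exists (lab x).
by apply: fin_bigcup_measurable => //; exact: finite_finset.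
Qed.

Lemma content_labels (q : pred V) :
  th [set x | q (lab x)] = \sum_(v | q v) th [set x | lab x = v].
Proof.
rewrite -big_filter; set s := [seq v <- _ | _].
have us : uniq s by rewrite filter_uniq // index_enum_uniq.
have -> : [set x | q (lab x)] = [set x | lab x \in s].
  by apply/seteqP; split => x /=; rewrite mem_filter mem_index_enum andbT.
elim: s us => [_|v s IH /= /andP[vs us]].
  by rewrite big_nil -[RHS]content0; congr th; apply/seteqP; split.
rewrite big_cons (contentI (measurable_labels (fun u => u \in v :: s)) (mlab v)).
congr (th _ + _).
  apply/seteqP; split => [x []//|x /= <-].
  by split; rewrite ?inE ?eqxx.
rewrite -IH//; congr th; apply/seteqP; split => x /=; rewrite inE.
  by case=> /orP[/eqP->|//] /(_ erefl).
move=> xs; rewrite xs orbT; split => // xv.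
by move: vs; rewrite -xv xs.
Qed.

(** First moment method: exchange the sum over the choices c with the sum over the
    labels.  A good label is selected by a proportion at most k of the choices; a bad
    one may be selected by all of them. *)
Lemma average_content (O : finType) (p : O -> pred V) (good : pred V) (k : R) :
  0 <= k ->
  (forall v, good v -> (#|[pred c | p c v]|%:R <= k * #|O|%:R :> R)) ->
  \sum_c th [set x | p c (lab x)] <=
    #|O|%:R * (k * th setT + th [set x | ~~ good (lab x)]).
Proof.
move=> k0 H.
under eq_bigr do rewrite content_labels.
rewrite (exchange_big_dep xpredT) //=.
have -> : th setT = \sum_v th [set x | lab x = v].
  by rewrite -(content_labels xpredT); congr th; apply/seteqP; split.
rewrite (content_labels (fun v => ~~ good v)) mulrDr !mulr_sumr (bigID good) /= lerD //.
  rewrite [leRHS](bigID good) /= -[leLHS]addr0 lerD //; last first.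
    by apply: sumr_ge0 => v _; rewrite !mulr_ge0 // content_ge0.
  apply: ler_sum => v /H Hv; rewrite sumr_const -[leLHS]mulr_natl mulrA [_ * k]mulrC.
  by apply: ler_wpM2r => //; exact: content_ge0.
apply: ler_sum => v _; rewrite sumr_const -[leLHS]mulr_natl.
by apply: ler_wpM2r; [exact: content_ge0|rewrite ler_nat max_card].
Qed.

End Fibres.
End Basic.

Lemma finite_content_sum (I : finType) (ths : I -> set X -> R) :
  (forall i, finite_content (ths i)) ->
  finite_content (fun A => \sum_i ths i A).
Proof.
move=> H; split.
- by move=> A mA; apply: sumr_ge0 => i _; exact: content_ge0.
- move=> A B mA mB; rewrite -big_split /=; apply: eq_bigr => i _.
  exact: contentI.
move=> F mF Fd F0.
have [i0 _|I0] := pickP (@predT I); last first.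
  by move=> e e0; exists 0%N; rewrite big_pred0 ?ltW.
have dF i j : (i <= j)%N -> F j `<=` F i.
  elim: j => [|j IH]; first by rewrite leqn0 => /eqP ->.
  by rewrite leq_eqVlt => /orP[/eqP ->//|/IH h]; apply: subset_trans h; exact: Fd.
move=> e e0.
have c0 : 0 < #|I|%:R :> R by rewrite ltr0n; apply/card_gt0P; exists i0.
have /choice[n Hn] : forall i, exists n, ths i (F n) <= e / #|I|%:R.
  by move=> i; apply: (content_vanish (H i)) => //; rewrite divr_gt0.
exists (\max_i n i)%N.
have -> : e = \sum_(i : I) e / #|I|%:R.
  by rewrite sumr_const -[RHS]mulr_natr divfK // gt_eqF.
apply: ler_sum => i _; apply: le_trans (Hn i).
by apply: (le_content (H i)) => //; apply: dF; exact: leq_bigmax.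
Qed.

Lemma finite_content_pull th (E : set X) (T : X -> X) : measurable E ->
  measurable_fun setT T ->
  finite_content th -> finite_content (fun A => th (E `&` T @^-1` A)).
Proof.
move=> mE mT H.
have mTi A : measurable A -> measurable (T @^-1` A).
  by move=> mA; rewrite -[_ @^-1` _]setTI; exact: mT.
split.
- by move=> A mA; apply: content_ge0 => //; apply: measurableI => //; exact: mTi.
- move=> A B mA mB.
  rewrite (contentI H (measurableI _ _ mE (mTi _ mA)) (mTi _ mB)).
  by congr (th _ + th _); rewrite preimage_setI ?setIA //= preimage_setD setIDA.
move=> F mF Fd F0 e e0; apply: (content_vanish H (F := fun n => E `&` T @^-1` F n)) => //.
- by move=> n; apply: measurableI => //; exact: mTi.
- by move=> n x [Ex Fx]; split => //; exact: Fd.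
by move=> x; have [n Hn] := F0 (T x); exists n => -[].
Qed.

End Content.

(** * Small hitting sets *)

Section Counting.
Local Open Scope nat_scope.

Lemma leq_expnS m n : m ^ n + n * m ^ n.-1 <= m.+1 ^ n.
Proof.
elim: n => [|n IH]; first by rewrite !expn0 mul0n addn0.
rewrite expnS [leqRHS]expnS /=; apply: leq_trans (leq_mul (leqnn m.+1) IH).
case: n {IH} => [|n] /=; rewrite ?expnS ?expn0 ?muln1; [lia|move: (m ^ n) => p; nia].
Qed.

(** Each block of m + 1 factors gains a factor 2, by Bernoulli. *)
Lemma leq_expn_half m K N : K * m.+1 <= N -> 2 ^ K * m ^ N <= m.+1 ^ N.
Proof.
move=> KN; rewrite -(subnKC KN) !expnD mulnA leq_mul //; last first.
  by case: (N - _) => [|j]; rewrite ?expn0 ?leq_exp2r.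
rewrite mulnC [K * _]mulnC !expnM -expnMn; case: K {KN} => // K; rewrite leq_exp2r //.
by apply: leq_trans (leq_expnS m m.+1); rewrite /= mulSn -expnS; lia.
Qed.

Lemma card_colorings_prod (L : finType) m (F : L -> pred 'I_m) :
  #|[pred c : {ffun L -> 'I_m} | [forall l, F l (c l)]]| = \prod_l #|F l|.
Proof.
rewrite -(_ : #|family F| = #|[pred c : {ffun L -> 'I_m} | [forall l, F l (c l)]]|) //.
by rewrite card_family foldrE big_map big_enum.
Qed.

Lemma card_colorings_at (L : finType) m (l : L) :
  m.+1 * #|[pred c : {ffun L -> 'I_m.+1} | c l == ord0]| = m.+1 ^ #|L|.
Proof.
pose F l' : pred 'I_m.+1 := if l' == l then pred1 ord0 else predT.
rewrite (_ : #|_| = \prod_l' #|F l'|).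
  rewrite (bigD1 l) //= /F eqxx card1 mul1n.
  rewrite (eq_bigr (fun=> m.+1)) => [|l' /negPf ->]; last exact: card_ord.
  by rewrite prod_nat_const cardC1 -expnS prednK //; apply/card_gt0P; exists l.
rewrite -card_colorings_prod; apply: eq_card => c; rewrite !inE.
apply/idP/forallP => [cl l'|/(_ l)]; rewrite /F ?eqxx //.
by case: eqP => [->|].
Qed.

(** A random colouring with m + 1 colours gives none of #|W| distinct labels
    the colour 0 with probability (1 - 1/(m + 1))^#|W|, which is at most 2^-K. *)
Lemma card_colorings_avoid (L W : finType) m K (V : W -> L) :
  injective V -> K * m.+1 <= #|W| ->
  2 ^ K * #|[pred c : {ffun L -> 'I_m.+1} | [forall e, c (V e) != ord0]]|
    <= m.+1 ^ #|L|.
Proof.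
move=> Vi KW; pose F l : pred 'I_m.+1 := if l \in codom V then predC1 ord0 else predT.
rewrite (_ : #|_| = \prod_l #|F l|); last first.
  rewrite -card_colorings_prod; apply: eq_card => c; rewrite !inE.
  apply/forallP/forallP => [H l|H e]; rewrite /F.
    by case: ifPn => // /codomP[e ->]; exact: H.
  by have := H (V e); rewrite /F codom_f.
rewrite (bigID (mem (codom V))) /=.
rewrite (eq_bigr (fun=> m)) => [|l lV]; last first.
  by rewrite /F lV cardC1 card_ord.
rewrite prod_nat_const card_codom // (eq_bigr (fun=> m.+1)) => [|l /negPf lV]; last first.
  by rewrite /F lV card_ord.
rewrite prod_nat_const mulnA.
rewrite -[X in _ <= _ ^ X](cardC (mem (codom V))) card_codom // expnD leq_mul //.
  exact: leq_expn_half.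
Qed.
End Counting.

Section Hitting.
Local Open Scope ring_scope.
Context (R : realType) d (X : measurableType d).
Variables (Bs : nat -> set X) (W : finType) (T : W -> X -> X) (e0 : W) (sg : X -> X).
Hypotheses (mBs : forall i, measurable (Bs i))
  (sepBs : forall x y, (forall i, Bs i x <-> Bs i y) -> x = y)
  (mT : forall e, measurable_fun setT (T e)) (msg : measurable_fun setT sg)
  (sgK : forall x, sg (T e0 x) = x) (T_inj : forall x, injective (T^~ x)).

Let lab n x : {ffun 'I_n -> bool} := [ffun i : 'I_n => `[< Bs i x >]].
Let labs n x : {ffun W -> {ffun 'I_n -> bool}} := [ffun e => lab n (T e (sg x))].

Let mpre (f : X -> X) A : measurable_fun setT f -> measurable A -> measurable (f @^-1` A).
Proof. by move=> mf mA; rewrite -[_ @^-1` _]setTI; exact: mf. Qed.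

Let mlab n v : measurable [set x | lab n x = v].
Proof.
have -> : [set x | lab n x = v] =
    \bigcap_(i in [set: 'I_n]) (if v i then Bs i else ~` Bs i).
  apply/seteqP; split => [x <- i _|x H].
    by rewrite ffunE; case: asboolP.
  apply/ffunP => i; rewrite ffunE; have := H i I.
  by case: (v i) => Bi; [apply/asboolP|apply/asboolPn].
apply: fin_bigcap_measurable; first exact: finite_finset.
by move=> i _; case: (v i) => //; apply: measurableC.
Qed.

Let mlabs n v : measurable [set x | labs n x = v].
Proof.
have -> : [set x | labs n x = v] =
    \bigcap_(e in [set: W]) ((T e \o sg) @^-1` [set y | lab n y = v e]).
  apply/seteqP; split => [x <- e _|x H]; first by rewrite /= ffunE.
  by apply/ffunP => e; rewrite ffunE; exact: H.
apply: fin_bigcap_measurable; first exact: finite_finset.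
by move=> e _; apply: mpre => //; exact: measurableT_comp.
Qed.

Let unsep n : set X := [set x | ~~ injectiveb (labs n x)].

Let munsep n : measurable (unsep n).
Proof. exact: (measurable_labels (mlabs (n := n)) (fun v => ~~ injectiveb v)). Qed.

Let unsep_decr n : unsep n.+1 `<=` unsep n.
Proof.
move=> x /= /injectivePn [e [e' ee' H]]; apply/injectivePn; exists e, e' => //.
move: H; rewrite !ffunE => /ffunP H; apply/ffunP => i.
by have := H (widen_ord (leqnSn n) i); rewrite !ffunE.
Qed.

Let unsep_vanish x : exists n, ~ unsep n x.
Proof.
have /choice[m Hm] : forall ee : W * W, exists n : nat,
    ee.1 != ee.2 -> ~ (Bs n (T ee.1 (sg x)) <-> Bs n (T ee.2 (sg x))).
  move=> [e e'] /=; apply: contrapT => /forallNP H.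
  have ee' : e != e' by apply/negP => /eqP ee; apply: (H 0%N); rewrite ee eqxx.
  have /T_inj : T e (sg x) = T e' (sg x).
    by apply: sepBs => i; apply: contrapT => ni; apply: (H i).
  by move/eqP: ee'.
exists (\max_ee (m ee)).+1; apply/negP; rewrite negbK; apply/injectiveP => e e'.
rewrite !ffunE => /ffunP H; apply: contrapT => /eqP ee'.
have lt : (m (e, e') < (\max_ee (m ee)).+1)%N by rewrite ltnS leq_bigmax.
have := H (Ordinal lt); rewrite !ffunE /= => E.
by apply: (Hm (e, e') ee'); split => /asboolP h; apply/asboolP; [rewrite -E|rewrite E].
Qed.

(** Label each point by its membership in finitely many sets of a separating family
    and colour the labels at random with 2^K colours.  The points of colour 0 have small
    content on average.  A point misses colour 0 on all its translates with
    small probability as soon as these have distinct labels, which holds up to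
    small content when enough sets are used; such points are added, moved
    by T e0 so that their orbit hits P too.  Markov's inequality gives one colouring
    that works for both contents. *)
Theorem small_hitting_set (th1 th2 : set X -> R) (K : nat) :
  finite_content th1 -> finite_content th2 -> (K * 2 ^ K <= #|W|)%N ->
  exists P : set X, [/\ measurable P, forall x, exists e, P (T e x),
    th1 P <= 6 / 2 ^+ K * th1 setT & th2 P <= 6 / 2 ^+ K * th2 setT].
Proof.
move=> fc1 fc2 KW.
have [m mE] : exists m, m.+1 = (2 ^ K)%N.
  by exists (2 ^ K).-1; rewrite prednK // expn_gt0.
(* the frequency of each colour, and the size of every error term *)
set eta : R := 2^-1 ^+ K.
have eta0 : 0 < eta by rewrite exprn_gt0.
have etaE : eta * (2 ^ K)%:R = 1 by rewrite natrX /eta -exprMn mulVf ?expr1n // pnatr_eq0.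
have etaV : 6 / 2 ^+ K = 6 * eta by rewrite /eta exprVn.
rewrite etaV.
have sep th : finite_content th -> exists n0, forall n, (n0 <= n)%N ->
    th (unsep n) <= eta * th setT.
  move=> fc; have := content_ge0 fc (@measurableT _ X); rewrite le_eqVlt.
  case/orP => [/eqP th0|thT].
    exists 0%N => n _; rewrite -th0 mulr0 th0.
    exact: (le_content fc).
  have [|n0 Hn0] := content_vanish fc munsep unsep_decr unsep_vanish (e := eta * th setT).
    exact: mulr_gt0.
  exists n0 => n nn0; apply: le_trans Hn0.
  apply: (le_content fc) => //.
  elim: n nn0 => [|n IH]; first by rewrite leqn0 => /eqP ->.
  rewrite leq_eqVlt => /orP[/eqP ->//|/IH h].
  by apply: subset_trans h; exact: unsep_decr.
have [n1 Hn1] := sep _ fc1; have [n2 Hn2] := sep _ fc2.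
pose n := maxn n1 n2.
pose O : finType := {ffun {ffun 'I_n -> bool} -> 'I_m.+1}.
pose Q (c : O) : set X := [set x | c (lab n x) == ord0].
pose F (c : O) : set X := [set x | [forall e, c (labs n x e) != ord0]].
have mQ c : measurable (Q c).
  exact: (measurable_labels (mlab (n := n)) (fun v => c v == ord0)).
have mF c : measurable (F c).
  exact: (measurable_labels (mlabs (n := n)) (fun v => [forall e, c (v e) != ord0])).
have cO : #|O| = (m.+1 ^ #|{ffun 'I_n -> bool}|)%N by rewrite card_ffun card_ord.
have O0 : 0 < #|O|%:R :> R by rewrite ltr0n cO expn_gt0.
(* one eta each for colour 0, for missed hits and for unseparated points *)
have avg th : finite_content th -> (forall n', (n <= n')%N -> th (unsep n') <= eta * th setT) ->
    \sum_c th (Q c `|` F c) <= #|O|%:R * (3 * eta * th setT).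
  move=> fc thn.
  apply: (@le_trans _ _ (\sum_c (th (Q c) + th (F c)))).
    by apply: ler_sum => c _; exact: contentU.
  rewrite big_split /=.
  have -> : 3 * eta * th setT = eta * th setT + (eta * th setT + eta * th setT) by ring.
  rewrite mulrDr lerD //.
    have cQ (v : {ffun 'I_n -> bool}) : xpredT v ->
        #|[pred c : O | c v == ord0]|%:R <= eta * #|O|%:R.
      move=> _; rewrite -(ler_pM2r (_ : 0 < (2 ^ K)%:R)) ?ltr0n ?expn_gt0 //.
      rewrite mulrAC etaE mul1r -natrM ler_nat mulnC -mE.
      by rewrite card_colorings_at cO.
    have := average_content fc (mlab (n := n)) (ltW eta0) cQ.
    rewrite (_ : [set x | ~~ true] = set0) ?(content0 fc) ?addr0 //.
    by apply/seteqP; split.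
  have cF (v : {ffun W -> {ffun 'I_n -> bool}}) : injectiveb v ->
      #|[pred c : O | [forall e, c (v e) != ord0]]|%:R <= eta * #|O|%:R.
    move=> /injectiveP vi; rewrite -(ler_pM2r (_ : 0 < (2 ^ K)%:R)) ?ltr0n ?expn_gt0 //.
    rewrite mulrAC etaE mul1r -natrM ler_nat mulnC cO.
    by apply: card_colorings_avoid => //; rewrite mE.
  apply: le_trans (average_content fc (mlabs (n := n)) (ltW eta0) cF) _.
  by rewrite ler_pM2l // lerD2l; exact: thn.
have avg1 := avg _ fc1 (fun n' h => Hn1 n' (leq_trans (leq_maxl n1 n2) h)).
have avg2 := avg _ fc2 (fun n' h => Hn2 n' (leq_trans (leq_maxr n1 n2) h)).
suff [c [H1 H2]] : exists c, th1 (Q c `|` F c) <= 6 * eta * th1 setT /\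
                       th2 (Q c `|` F c) <= 6 * eta * th2 setT.
  exists (Q c `|` F c); split => //; first exact: measurableU.
  move=> x; have [[e He]|nQ] := pselect (exists e, Q c (T e x)).
    by exists e; left.
  exists e0; right; rewrite /F /=; apply/forallP => e; rewrite ffunE sgK.
  by apply/negP => h; apply: nQ; exists e.
(* otherwise the two ratios add up to more than 6 eta for every colouring, while
   the average of each is at most 3 eta *)
apply: contrapT => nc.
have mQF c : measurable (Q c `|` F c) by exact: measurableU.
have norm th (c : O) : finite_content th ->
   th (Q c `|` F c) / th setT <= 6 * eta -> th (Q c `|` F c) <= 6 * eta * th setT.
  move=> fc; have := content_ge0 fc (@measurableT _ X); rewrite le_eqVlt.
  case/orP => [/eqP th0 _|thT]; last by rewrite ler_pdivrMr.
  by rewrite -th0 mulr0 th0; exact: (le_content fc).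
have : \sum_(c : O) (6 * eta) < \sum_c (th1 (Q c `|` F c) / th1 setT + th2 (Q c `|` F c) / th2 setT).
  apply: ltr_sum; first by apply/hasP; exists [ffun=> ord0]; rewrite ?mem_index_enum.
  move=> c _; rewrite ltNge; apply/negP => H; apply: nc; exists c.
  have p1 : 0 <= th1 (Q c `|` F c) / th1 setT by rewrite divr_ge0 // content_ge0.
  have p2 : 0 <= th2 (Q c `|` F c) / th2 setT by rewrite divr_ge0 // content_ge0.
  by split; apply: norm => //; lra.
apply/negP; rewrite -leNgt big_split /= -!mulr_suml sumr_const -mulr_natl.
have bnd th : finite_content th -> \sum_c th (Q c `|` F c) <= #|O|%:R * (3 * eta * th setT) ->
   (\sum_c th (Q c `|` F c)) / th setT <= #|O|%:R * (3 * eta).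
  move=> fc H; have := content_ge0 fc (@measurableT _ X); rewrite le_eqVlt.
  case/orP => [/eqP <-|thT]; last by rewrite ler_pdivrMr // -mulrA.
  by rewrite invr0 mulr0 !mulr_ge0 // ltW.
have := bnd _ fc1 avg1; have := bnd _ fc2 avg2; lra.
Qed.

End Hitting.

Section Measurability.
Local Open Scope ring_scope.

Lemma measurable_preim d (X : measurableType d) (f : X -> X) (A : set X) :
  measurable_fun setT f -> measurable A -> measurable (f @^-1` A).
Proof. by move=> mf mA; rewrite -[_ @^-1` _]setTI; exact: mf. Qed.

Lemma metric_ball_open (R : realType) (Y : metricType R) (y : Y) (r : R) :
  open (ball y r).
Proof.
rewrite openE => z yz; apply/nbhs_ballP; move: yz; rewrite ballEmdist /= => yz.
exists (r - mdist y z); first by rewrite /= subr_gt0.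
move=> t; rewrite !ballEmdist /= ltrBrDl; apply: le_lt_trans.
exact: metric_triangle.
Qed.

(** Preimages of the balls of radius 1/(j + 1) around a dense sequence; to get
    open sets indexed by all pairs of naturals, the centres with number i are collected
    into a union, which has at most one member. *)
Lemma standard_borel_separating (R : realType) d (X : measurableType d) :
  standard_borel R X ->
  exists Bs : nat -> set X, (forall i, measurable (Bs i)) /\
    forall x y, (forall i, Bs i x <-> Bs i y) -> x = y.
Proof.
move=> [Y [f [[_ [D /countable_injP[h hinj] Dd]] fbij fB]]].
pose U (ij : nat * nat) : set Y := \bigcup_(y in D `&` [set y | h y = ij.1]) ball y ij.2.+1%:R^-1.
exists (fun n => if unpickle n is Some ij then f @^-1` U ij else set0); split.
  move=> n; case: unpickle => [ij|]; last exact: measurable0.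
  apply/fB; apply: sub_sigma_algebra.
  by apply: bigcup_open => y _; exact: metric_ball_open.
move=> x y H; apply: (bij_inj fbij); apply/eqP; apply: contrapT => /negP fxy.
have [j jlt] : exists j : nat, j.+1%:R^-1 < mdist (f x) (f y) / 2.
  have [n _ Hn] := near_infty_natSinv_lt (PosNum (divr_gt0 (etrans (mdist_gt0 (f x) (f y)) fxy) (ltr0n R 2))).
  by exists n; exact: (Hn n (leqnn n)).
have [z [zx zD]] : (ball (f x) j.+1%:R^-1 `&` D) !=set0.
  apply: Dd; last exact: metric_ball_open.
  by exists (f x); apply: ballxx; rewrite invr_gt0.
have := H (pickle (h z, j)); rewrite pickleK /= => -[+ _].
case; first by exists z => //; exact: ball_sym.
move=> z' [z'D /= hz'] z'y; have zz : z' = z by apply: hinj; rewrite ?inE.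
move: zx z'y; rewrite zz !ballEmdist /= => zx zy.
have := lt_trans (le_lt_trans (metric_triangle (f x) z (f y)) (ltrD zx zy)) (ltrD jlt jlt).
by rewrite -splitr ltxx.
Qed.

Lemma finite_content_measure (R : realType) d (X : measurableType d)
  (mu : probability X R) : finite_content (fun A => fine (mu A)).
Proof.
have fin A : measurable A -> mu A \is a fin_num by move=> mA; exact: fin_num_measure.
split.
- by move=> A mA; apply: fine_ge0.
- move=> A B mA mB; rewrite -fineD ?fin //; [|exact: measurableI|exact: measurableD].
  congr fine; rewrite -measureU //; first by rewrite setUIDK.
  + exact: measurableI.
  + exact: measurableD.
  + by apply/seteqP; split => x //= [[_ ?] [_ ?]].
move=> F mF Fd F0 e e0.
have F0' : \bigcap_n F n = set0.
  by apply/seteqP; split => // x Fx; have [n] := F0 x; apply; exact: Fx.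
have cv : mu (F n) @[n --> \oo] --> mu (\bigcap_n F n).
  apply: nonincreasing_cvg_mu => //.
  - by rewrite ltey_eq fin.
  - by rewrite F0'; exact: measurable0.
  - move=> n m nm; apply/subsetPset.
    elim: m nm => [|m IH]; first by rewrite leqn0 => /eqP ->.
    rewrite leq_eqVlt => /orP[/eqP ->//|/IH h]; apply: subset_trans h; exact: Fd.
move: cv; rewrite F0' measure0 => /fine_cvgP[_ /cvgrPdist_lt /(_ e e0) [n _ Hn]].
exists n; have := Hn n (leqnn n); rewrite /= sub0r normrN.
by move=> h; apply: le_trans (ler_norm _) (ltW h).
Qed.

End Measurability.

(** * A choice of letters that increases a rank *)

Section FiniteUnion.
Local Open Scope ring_scope.

Lemma contentU_fin (R : realType) d (X : measurableType d) (th : set X -> R)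
  (I : finType) (F : I -> set X) : finite_content th ->
  (forall i, measurable (F i)) ->
  th [set x | exists i, F i x] <= \sum_i th (F i).
Proof.
move=> fc mF.
have -> : [set x | exists i, F i x] = [set x | exists2 i, i \in index_enum I & F i x].
  apply/seteqP; split => x [i]; last by exists i.
  by exists i => //; rewrite mem_index_enum.
have mFs (s : seq I) : measurable [set x | exists2 i, i \in s & F i x].
  have -> : [set x | exists2 i, i \in s & F i x] = \bigcup_(i in [set` s]) F i.
    by apply/seteqP; split => x [i]; exists i.
  by apply: fin_bigcup_measurable.
elim: (index_enum I) => [|i s IH].
  rewrite big_nil -[leRHS](content0 fc) le_eqVlt; apply/orP; left; apply/eqP.
  by congr th; apply/seteqP; split => // x [].
rewrite big_cons; apply: (@le_trans _ _ (th (F i) + th [set x | exists2 i, i \in s & F i x])).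
  apply: le_trans (contentU fc (mF i) (mFs s)).
  apply: (le_content fc) => //; first exact: measurableU.
  by move=> x [j]; rewrite inE => /orP[/eqP ->|js] Fj; [left|right; exists j].
by rewrite lerD2l.
Qed.

End FiniteUnion.

Section Increasing.
Context (R : realType) (G : groupType) d (X : measurableType d) (a : G -> X -> X).
Variables (mu : probability X R) (al be : G) (en : nat -> G).
Hypotheses (en_surj : forall g, exists n, en n = g) (Xsb : standard_borel R X)
  (a_borel : borel_action a) (a_free : free_action a)
  (words_inj : forall s t : seq bool, size s = size t ->
     eval_seq al be s = eval_seq al be t -> s = t).
Local Notation ev := (eval_seq al be).

Let a1 x : a 1 x = x. Proof. by case: a_borel. Qed.
Let aM g h x : a (g * h) x = a g (a h x). Proof. by case: a_borel. Qed.
Let ma g : measurable_fun setT (a g). Proof. by case: a_borel. Qed.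
Let aK g x : a g^-1 (a g x) = x. Proof. by rewrite -aM mulVg a1. Qed.
Let mpre g A : measurable A -> measurable (a g @^-1` A).
Proof. exact: measurable_preim. Qed.

Local Open Scope ring_scope.

(** The number of words of length r n is 2^(r n) = K n * 2^(K n), the number
    needed to hit a set of density about 2^-(K n).  The
    two ends of a road from P n.+1 to P n.+2 contribute the densities 2^-(K n.+1) and
    2^-(K n.+2), and there are K n.+2 * 2^(K n.+2) words to follow, so such
    roads fill about K n.+2 * 2^-(K n.+1) of the space.  This is summable because K n.+2 is only
    twice K n.+1; starting with the exponent 5 absorbs the constants. *)
Let K n := (2 ^ (n + 5))%N.
Let r n := (K n + (n + 5))%N.

(** Adding one more translate of mu at each level lets one Borel-Cantelli
    argument, over the levels, control all the translates of mu. *)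
Definition mu_ n (A : set X) : R := \sum_(i < n.+1) fine (mu (a (en i) @^-1` A)).

Let mu_fc n : finite_content (mu_ n).
Proof.
apply: finite_content_sum => i.
have := finite_content_pull (@measurableT _ X) (ma (en i)) (finite_content_measure mu).
by under eq_fun do rewrite setTI.
Qed.

(** The points reached after i steps of a path of r steps from P to Q. *)
Definition road (P Q : set X) (r i : nat) : set X :=
  [set x | (i <= r)%N /\ exists s : r.-tuple bool,
     P (a (ev (take i s))^-1 x) /\ Q (a (ev (drop i s)) x)].

(** lam n P A counts the roads from P to A with their number of steps made: it bounds the
    content of the points on such roads, and for fixed P it is a finite content in
    A, with total mass nu n P.  So a hitting set that is small for lam n P leaves few
    roads, and if it is also small for nu n.+1 the construction goes on. *)
Definition nu n (A : set X) : R :=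
  \sum_(i < (r n.+1).+1) \sum_(s : (r n.+1).-tuple bool)
    mu_ n (a (ev (take i s))^-1 @^-1` A).

Definition lam n (P A : set X) : R :=
  \sum_(i < (r n.+1).+1) \sum_(s : (r n.+1).-tuple bool)
    mu_ n (a (ev (take i s))^-1 @^-1` P `&` a (ev (drop i s)) @^-1` A).

Let nu_fc n : finite_content (nu n).
Proof.
apply: finite_content_sum => i; apply: finite_content_sum => s.
have := finite_content_pull (@measurableT _ X) (ma (ev (take i s))^-1) (mu_fc n).
by under eq_fun do rewrite setTI.
Qed.

Let lam_fc n P : measurable P -> finite_content (lam n P).
Proof.
move=> mP; apply: finite_content_sum => i; apply: finite_content_sum => s.
by apply: finite_content_pull => //; exact: mpre.
Qed.

Let lamT n P : lam n P setT = nu n P.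
Proof.
apply: eq_bigr => i _; apply: eq_bigr => s _.
by rewrite preimage_setT setIT.
Qed.

Let mu_T n : mu_ n setT = n.+1%:R.
Proof.
rewrite /mu_ (eq_bigr (fun=> 1)) => [|i _]; first by rewrite sumr_const card_ord.
by rewrite preimage_setT probability_setT.
Qed.

Let nuT n : nu n setT = ((r n.+1).+1 * 2 ^ r n.+1 * n.+1)%:R.
Proof.
rewrite /nu (eq_bigr (fun=> (2 ^ r n.+1 * n.+1)%:R)) => [|i _].
  by rewrite sumr_const card_ord -mulrnA mulnC mulnA.
rewrite (eq_bigr (fun=> n.+1%:R)) => [|s _]; last by rewrite preimage_setT mu_T.
by rewrite sumr_const card_tuple card_bool -mulrnA mulnC.
Qed.

Let hits (P : set X) n := forall x, exists s : n.-tuple bool, P (a (ev s) x).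

Let next n (P : set X) : measurable P -> exists Q : set X,
  [/\ measurable Q, hits Q (r n.+1),
      lam n P Q <= 6 / 2 ^+ K n.+1 * nu n P &
      nu n.+1 Q <= 6 / 2 ^+ K n.+1 * nu n.+1 setT].
Proof.
move=> mP; have [Bs [mBs sepBs]] := standard_borel_separating Xsb.
pose T (s : (r n.+1).-tuple bool) := a (ev s).
pose e0 : (r n.+1).-tuple bool := nseq_tuple _ true.
have [] := @small_hitting_set R d X Bs _ T e0 (a (ev e0)^-1) mBs sepBs _ _ _ _
   (lam n P) (nu n.+1) (K n.+1) (lam_fc n mP) (nu_fc n.+1).
- by move=> s; exact: ma.
- exact: ma.
- by move=> x; exact: aK.
- move=> x s t /= st; apply: val_inj; apply: words_inj; first by rewrite !size_tuple.
  apply: (mulgI (ev t)^-1%g); rewrite mulVg; apply: (a_free (x := x)).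
  by rewrite aM [a (ev s) x]st aK.
- by rewrite card_tuple card_bool /r expnD mulnC.
by move=> Q [mQ hQ lQ nQ]; exists Q; rewrite -lamT.
Qed.

Let exists_nets : exists P : nat -> set X, [/\ P 0%N = setT,
   forall n, measurable (P n), forall n, hits (P n.+1) (r n.+1),
   forall n, lam n (P n) (P n.+1) <= 6 / 2 ^+ K n.+1 * nu n (P n) &
   forall n, nu n.+1 (P n.+1) <= 6 / 2 ^+ K n.+1 * nu n.+1 setT].
Proof.
have /choice[f Hf] : forall nP : nat * {P : set X | measurable P},
    exists Q : {P : set X | measurable P},
  [/\ hits (sval Q) (r nP.1.+1),
      lam nP.1 (sval nP.2) (sval Q) <= 6 / 2 ^+ K nP.1.+1 * nu nP.1 (sval nP.2) &
      nu nP.1.+1 (sval Q) <= 6 / 2 ^+ K nP.1.+1 * nu nP.1.+1 setT].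
  by move=> [n [P mP]] /=; have [Q [mQ ? ? ?]] := next n mP; exists (exist _ Q mQ).
pose P := fix P n := if n is m.+1 then f (m, P m) else exist _ setT measurableT.
exists (fun n => sval (P n)); split => //.
- by move=> n; case: (P n).
- by move=> n; have [] := Hf (n, P n).
- by move=> n; have [] := Hf (n, P n).
- by move=> n; have [] := Hf (n, P n).
Qed.

Let mroad P Q m i : measurable P -> measurable Q -> measurable (road P Q m i).
Proof.
move=> mP mQ; case: (leqP i m) => im; last first.
  rewrite (_ : road P Q m i = set0) //.
  by apply/seteqP; split => // x [ile _]; move: im; rewrite ltnNge ile.
have -> : road P Q m i = \bigcup_(s in [set: m.-tuple bool])
    (a (ev (take i s))^-1 @^-1` P `&` a (ev (drop i s)) @^-1` Q).
  by apply/seteqP; split => [x [_ [s [? ?]]]|x [s _ [? ?]]]; [exists s|split => //; exists s].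
apply: fin_bigcup_measurable => [|s _]; first exact: finite_finset.
by apply: measurableI; exact: mpre.
Qed.

Let roads P Q m : set X := [set x | exists i, road P Q m i x].

Let mroads P Q m : measurable P -> measurable Q -> measurable (roads P Q m).
Proof.
move=> mP mQ; have -> : roads P Q m = \bigcup_i road P Q m i.
  by apply/seteqP; split => x [i]; exists i.
by apply: bigcup_measurable => i _; exact: mroad.
Qed.

Let le_roads n P Q : measurable P -> measurable Q ->
  mu_ n (roads P Q (r n.+1)) <= lam n P Q.
Proof.
move=> mP mQ; rewrite /lam pair_bigA /=.
pose F (p : 'I_(r n.+1).+1 * (r n.+1).-tuple bool) : set X :=
  a (ev (take p.1 p.2))^-1 @^-1` P `&` a (ev (drop p.1 p.2)) @^-1` Q.
have mF p : measurable (F p) by apply: measurableI; exact: mpre.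
apply: le_trans (contentU_fin (mu_fc n) mF).
rewrite le_eqVlt; apply/orP; left; apply/eqP; congr mu_; apply/seteqP; split.
  by move=> x [i [ir [s sx]]]; exists (Ordinal (ir : (i < (r n.+1).+1)%N), s).
by move=> x [[i s] sx]; exists i; split; [rewrite -ltnS|exists s].
Qed.

(** The factor 36 comes from the two densities 6 / 2^K, the factor 2^n.+1 is the
    wanted rate of convergence, and the middle one is the total mass of nu n.+1. *)
Let growth n : (36 * ((r n.+2).+1 * 2 ^ r n.+2 * n.+2) * 2 ^ n.+1
   <= 2 ^ K n.+2 * 2 ^ K n.+1)%N.
Proof.
have Ksq : (8 + 4 * (n + 6) <= 2 ^ (n + 6))%N.
  by elim: n => // n; rewrite addSn expnS; move: (2 ^ (n + 6))%N => q; lia.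
rewrite {2}/r expnD.
have -> : K n.+2 = (2 * K n.+1)%N by rewrite /K addSn expnS.
set k := K n.+1; have kE : k = (2 ^ (n + 6))%N by rewrite /k /K addSnnS.
have E2 : (2 ^ (n.+2 + 5) = 2 * k)%N by rewrite kE addSnnS addSn expnS.
have rE : ((r n.+2).+1 <= 3 * k)%N.
  by rewrite /r /K E2 kE; lia.
have nk : (n.+2 <= k)%N by rewrite kE; lia.
have n2k : (2 ^ n.+1 <= k)%N by rewrite kE leq_exp2l //; lia.
rewrite E2.
have k4 : (216 * (k * k * k * k) <= 2 ^ k)%N.
  apply: (@leq_trans (2 ^ (8 + 4 * (n + 6)))); last by rewrite leq_exp2l ?kE.
  by rewrite [leqRHS]expnD leq_mul // kE -!expnD leq_exp2l //; lia.
rewrite [leqRHS]mulnC.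
apply: (@leq_trans (216 * (k * k * k * k) * 2 ^ (2 * k))); last by rewrite leq_mul.
have -> : (36 * ((r n.+2).+1 * (2 ^ (2 * k) * (2 * k)) * n.+2) * 2 ^ n.+1 =
   72 * k * ((r n.+2).+1 * n.+2 * 2 ^ n.+1) * 2 ^ (2 * k))%N by ring.
rewrite leq_mul // (_ : 216 * (k * k * k * k) = 72 * k * (3 * k * k * k))%N; last by ring.
by rewrite leq_mul // leq_mul // leq_mul.
Qed.

Let mu_roads (P : nat -> set X) : (forall n, measurable (P n)) ->
   (forall n, lam n (P n) (P n.+1) <= 6 / 2 ^+ K n.+1 * nu n (P n)) ->
   (forall n, nu n.+1 (P n.+1) <= 6 / 2 ^+ K n.+1 * nu n.+1 setT) ->
   forall n, mu_ n.+1 (roads (P n.+1) (P n.+2) (r n.+2)) <= (2 ^ n.+1)%:R^-1.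
Proof.
move=> mP lP nP n.
apply: le_trans (le_roads _ (mP _) (mP _)) _; apply: le_trans (lP _) _.
have c0 m : 0 < 2 ^+ m :> R by rewrite exprn_gt0.
apply: le_trans (ler_wpM2l _ (nP n)) _; first by rewrite divr_ge0 // ltW.
rewrite nuT; have := growth n; rewrite -(ler_nat R).
move: (_ * 2 ^ _ * _)%N => M; rewrite !natrM !natrX.
move: (c0 (K n.+2)) (c0 (K n.+1)) (c0 n.+1).
move: (2 ^+ K n.+2) (2 ^+ K n.+1) (2 ^+ n.+1) => x y z x0 y0 z0 H.
have -> : 6 / x * (6 / y * M%:R) = 36 * M%:R / (x * y).
  by field; rewrite !gt_eqF.
by rewrite ler_pdivrMr ?mulr_gt0 // [leRHS]mulrC ler_pdivlMr.
Qed.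

(** Choose sets P n, with P 0 everything, such that a path of r n.+1 steps
    leads from each point to P n.+1, and such that the roads from P n to P n.+1
    have summable content.  Then almost every point lies
    on roads of finitely many levels.  Its rank (n, i) consists of
    the last such level and of the largest number of steps made on a road of
    that level, and the chosen letter is the next step of this road.  This step increases i
    unless it reaches a higher level.  The road is never at its end,
    because the points of P n.+1 are on roads of level n.+1. *)
Theorem increasing_choice : exists (X0 D : set X) (rk : X -> nat * nat),
  [/\ measurable X0, invariant_set a X0, mu X0 = 1%E, measurable D &
      forall x, X0 x -> rank_lt (rk x) (rk (if `[< D x >] then a al x else a be x))].
Proof.
have [P [P0 mP hP lP nP]] := exists_nets.
pose A n i := road (P n) (P n.+1) (r n.+1) i.
pose RA n := roads (P n) (P n.+1) (r n.+1).
have mA n i : measurable (A n i) by exact: mroad.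
have mRA n : measurable (RA n) by exact: mroads.
have mBn i n : measurable (a (en i) @^-1` RA n) by exact: mpre.
pose Bad i := lim_sup_set (fun n => a (en i) @^-1` RA n).
have mBad i : measurable (Bad i).
  by apply: bigcapT_measurable => n; apply: bigcup_measurable => j _.
have Bad0 i : mu (Bad i) = 0%E.
  (* mu_ n sees the i-th translate only from n = i on *)
  pose F n := a (en i) @^-1` RA (n + i).+1.
  have mF n : measurable (F n) by exact: mBn.
  have sub : Bad i `<=` lim_sup_set F.
    move=> x xB n _; have [m /= nm mx] := xB (n + i).+1 I.
    exists (m - i.+1)%N; first by rewrite /= leq_subRL; lia.
    by rewrite /F /= (_ : (m - i.+1 + i).+1 = m) //; lia.
  have F0 : mu (lim_sup_set F) = 0%E.
    apply: lim_sup_set_cvg0 => //.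
    apply: (@le_lt_trans _ _ (1%R%:E : \bar R)); last exact: ltry.
    apply: le_trans (epsilon_trick0 xpredT (@ler01 R)).
    apply: lee_nneseries => [n _ _|n _]; first exact: measure_ge0.
    apply: (@le_trans _ _ (fine (mu (F n)))%:E).
      by rewrite fineK // fin_num_measure.
    rewrite lee_fin div1r.
    apply: (@le_trans _ _ (mu_ (n + i).+1 (RA (n + i).+1))).
      have lti : (i < (n + i).+2)%N by lia.
      rewrite /mu_ (bigD1 (Ordinal lti)) //= lerDl.
      by apply: sumr_ge0 => j _; apply: fine_ge0.
    apply: le_trans (mu_roads mP lP nP (n + i)) _.
    by rewrite lef_pV2 ?posrE ?ltr0n ?expn_gt0 // ler_nat leq_exp2l //; lia.
  apply/eqP; rewrite eq_le measure_ge0 andbT -F0.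
  apply: le_measure => //; rewrite inE //.
  by apply: bigcapT_measurable => n; apply: bigcup_measurable => j _.
pose X0 : set X := ~` \bigcup_i Bad i.
have mX0 : measurable X0 by apply: measurableC; apply: bigcup_measurable => i _.
have X0inv : invariant_set a X0.
  move=> g x xX0 [i _ Bi]; apply: xX0.
  have [j jE] := en_surj (en i * g)%g; exists j => // n _.
  by have [m nm] := Bi n I; exists m => //; rewrite /= jE aM.
have X0mu : mu X0 = 1%E.
  rewrite /X0 probability_setC; last by apply: bigcup_measurable => i _.
  rewrite (_ : mu (\bigcup_i Bad i) = 0%E) ?sube0 //.
  apply/eqP; rewrite eq_le measure_ge0 andbT.
  apply: le_trans (measure_sigma_subadditive _ _ _ (fun t h => h)) _ => //.
    by apply: bigcup_measurable => i _.
  by rewrite eseries0 // => n _ _; exact: Bad0.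
have [e1 e1E] := en_surj 1%g.
have X0fin x : X0 x -> exists N, forall n, (N <= n)%N -> ~ RA n x.
  move=> xX0; apply: contrapT => /forallNP H; apply: xX0; exists e1 => // n _.
  have /existsNP[m /not_implyP[nm /contrapT mx]] := H n.
  by exists m => //=; rewrite e1E a1.
have hit_road n x : P n x -> A n 0%N x.
  move=> Px; split => //; have [s sx] := hP n x; exists s.
  by rewrite take0 drop0 /= invg1 a1.
pose Best n i x := [/\ A n i x, forall m, (n < m)%N -> ~ RA m x &
  forall j, (i < j)%N -> ~ A n j x].
have ex_best x : X0 x -> exists ni : nat * nat, Best ni.1 ni.2 x.
  move=> /X0fin[N HN].
  have exn : exists n, `[< RA n x >].
    by exists 0%N; apply/asboolP; exists 0%N; apply: hit_road; rewrite P0.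
  have ubn n : `[< RA n x >] -> (n <= N)%N.
    by move=> /asboolP h; rewrite leqNgt; apply/negP => /ltnW /HN; apply.
  have [n /asboolP [i0 nx] nmax] := ex_maxnP exn ubn.
  have exi : exists i, `[< A n i x >] by exists i0; apply/asboolP.
  have ubi i : `[< A n i x >] -> (i <= r n.+1)%N by move=> /asboolP[].
  have [i /asboolP ix imax] := ex_maxnP exi ubi.
  exists (n, i); split => //= [m nm /asboolP /nmax|j ij /asboolP /imax];
    by rewrite leqNgt ?nm ?ij.
have best_uniq x n i m j : Best n i x -> Best m j x -> (n, i) = (m, j).
  move=> [An n1 n2] [Am m1 m2].
  have nm : n = m.
    apply/eqP; rewrite eqn_leq; apply/andP; split; rewrite leqNgt; apply/negP.
      by move/m1; apply; exists i.
    by move/n1; apply; exists j.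
  move: An n1 n2; rewrite nm => An n1 n2.
  congr (_, _); apply/eqP; rewrite eqn_leq; apply/andP; split; rewrite leqNgt; apply/negP.
    by move/m2; apply.
  by move/n2; apply.
have mBest n i : measurable [set x | Best n i x].
  have -> : [set x | Best n i x] = A n i `&`
      (\bigcap_(m in [set m | (n < m)%N]) ~` RA m `&` \bigcap_(j in [set j | (i < j)%N]) ~` A n j).
    apply/seteqP; split => [x [xA xm xj]|x [xA [xm xj]]].
      by split.
    by split.
  apply: measurableI => //; apply: measurableI; apply: bigcap_measurableType => j _;
    exact: measurableC.
have /choice[rk rkP] : forall x, exists ni : nat * nat, X0 x -> Best ni.1 ni.2 x.
  move=> x; have [/ex_best [ni H]|nx] := pselect (X0 x); first by exists ni.
  by exists (0%N, 0%N).
pose D : set X := [set x | exists n i, Best n i x /\ A n i.+1 (a al x)].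
exists X0, D, rk; split => //.
  have -> : D = \bigcup_n \bigcup_i ([set x | Best n i x] `&` a al @^-1` A n i.+1).
    by apply/seteqP; split => [x [n [i h]]|x [n _ [i _ h]]]; [exists n => //; exists i|exists n, i].
  apply: bigcup_measurable => n _; apply: bigcup_measurable => i _.
  by apply: measurableI => //; exact: mpre.
move=> x xX0; have := rkP _ xX0; case: (rk x) => n i /= xB.
suff yA : A n i.+1 (if `[< D x >] then a al x else a be x).
  have yX0 : X0 (if `[< D x >] then a al x else a be x).
    by case: asboolP => _; exact: X0inv.
  have [_ + +] := rkP _ yX0; case: (rk _) => m j /= H1 H2.
  rewrite /rank_lt /=; case: (ltngtP n m) => //= nm.
    by case: (H1 n nm); exists i.+1.
  by rewrite ltnNge; apply/negP => ji; apply: (H2 i.+1) => //; rewrite -nm.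
case: asboolP => [[m [j [xB' yA]]]|xD]; first by have [-> ->] := best_uniq _ _ _ _ _ xB xB'.
have [[ir [s [sP sQ]]] xn xi] := xB.
have iltr : (i < r n.+1)%N.
  rewrite ltn_neqAle ir andbT; apply/negP => /eqP iE; apply: (xn n.+1 (leqnn _)).
  exists 0%N; apply: hit_road; move: sQ; rewrite iE drop_oversize ?size_tuple //.
  by rewrite /= a1.
have sdrop : drop i s = nth false s i :: drop i.+1 s by rewrite -drop_nth // size_tuple.
have stake : take i.+1 s = rcons (take i s) (nth false s i) by rewrite -take_nth // size_tuple.
have yA : A n i.+1 (a (letter al be (nth false s i)) x).
  split => //; exists s; split.
    by rewrite stake eval_seq_rcons invgM aM aK.
  by move: sQ; rewrite sdrop /= aM.
move: yA; case: (nth false s i) => //= yA.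
by case: xD; exists n, i.
Qed.
End Increasing.

(** * Measure strong free factors *)

Lemma measurable_graph d (X : measurableType d) (Bs : nat -> set X) (f : X -> X) :
  (forall i, measurable (Bs i)) ->
  (forall x y, (forall i, Bs i x <-> Bs i y) -> x = y) ->
  measurable_fun setT f -> measurable [set p : X * X | f p.1 = p.2].
Proof.
move=> mB sepB mf.
have -> : [set p : X * X | f p.1 = p.2] =
    \bigcap_i ((f @^-1` Bs i) `*` Bs i `|` (f @^-1` ~` Bs i) `*` ~` Bs i).
  apply/seteqP; split => [[x y] /= <- i _|[x y] H].
    by have [?|?] := pselect (Bs i (f x)); [left|right].
  by apply: sepB => i; have [[/= ? ?]|[/= ? ?]] := H i I; split.
apply: bigcapT_measurable => i; apply: measurableU; apply: measurableX => //.
- exact: measurable_preim.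
- by apply: measurable_preim => //; exact: measurableC.
- exact: measurableC.
Qed.

Lemma cyclic_sequence_walk (X : Type) (E1 E2 : set (X * X)) (n : nat) (x : 'Z_(2 * n) -> X) :
  (0 < n)%N ->
  (forall i, E1 (x (i *+ 2), x (i *+ 2 + 1)))%R ->
  (forall i, E2 (x (i *+ 2 + 1), x (i *+ 2 + 2)))%R ->
  (forall j, x j <> x (j + 1))%R ->
  exists y, walk (fun u v => E1 (u, v)) (fun u v => E2 (u, v)) false (2 * n) y /\
    y 0%N = y (2 * n)%N.
Proof.
move=> n0 x1 x2 xn; exists (fun k => x (k%:R)%R); split; last first.
  by rewrite -[in RHS](@Zp_nat_mod (2 * n)) ?modnn //; lia.
move=> i _; split; first by rewrite -natr1; exact: xn.
case: eqP => io.
  have := x1 (i./2)%:R%R; rewrite -mulrnA muln2 natr1.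
  by have -> : (i./2.*2 = i)%N by have := odd_double_half i; rewrite io.
have := x2 (i./2)%:R%R; rewrite -mulrnA muln2 natr1 -natrD.
have -> : (i./2.*2 + 2 = i.+1)%N by have := odd_double_half i; case: (odd i) io => //= _; lia.
by have -> : (i./2.*2.+1 = i)%N by have := odd_double_half i; case: (odd i) io.
Qed.

Section MSFF.
Context (R : realType) (G : groupType) (A B C U : set G) (en : nat -> G).
Hypotheses (sp : splitting A B C U) (tf : torsion_free G)
  (en_surj : forall g, exists n, en n = g).

Let measurable_blob d (X : measurableType d) (a : G -> X -> X) (X0 D : set X) :
  standard_borel R X -> (forall g, measurable_fun setT (a g)) ->
  measurable X0 -> measurable D ->
  measurable [set p : X * X | [/\ X0 p.1, X0 p.2 & blob a A B C D p.1 p.2]].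
Proof.
move=> /standard_borel_separating[Bs [mBs sepBs]] ma mX0 mD.
pose side (p : bool) := if p then D else ~` D.
have mside p : measurable (side p) by case: p => //; exact: measurableC.
pose piece n (pq : bool * bool) : set (X * X) :=
  if `[< link A B C pq.1 pq.2 (en n) >]
  then side pq.1 `*` side pq.2 `&` [set p | a (en n) p.1 = p.2] else set0.
have -> : [set p : X * X | [/\ X0 p.1, X0 p.2 & blob a A B C D p.1 p.2]] =
    X0 `*` X0 `&` \bigcup_n \bigcup_(pq in [set: bool * bool]) piece n pq.
  have dside p x : side p x <-> `[< D x >] = p.
    by rewrite /side; case: (asboolP (D x)) => Dx; case: p; split.
  apply/seteqP; split => [[x y] [/= X0x X0y [h hL hE]]|[x y] [[/= X0x X0y] [n _ [pq _]]]].
    split => //; have [n nE] := en_surj h; exists n => //.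
    exists (`[< D x >], `[< D y >]) => //; rewrite /piece /= nE asboolT //.
    by split => //; split; exact/dside.
  rewrite /piece; case: asboolP => // hL [[/dside xp /dside yq] /= E].
  by split => //; exists (en n); rewrite // xp yq.
apply: measurableI; first exact: measurableX.
apply: bigcup_measurable => n _; apply: fin_bigcup_measurable => [|pq _].
  exact: finite_finset.
rewrite /piece; case: asboolP => _ //; apply: measurableI; first exact: measurableX.
exact: (measurable_graph mBs sepBs (ma _)).
Qed.

(** The letters of the increasing choice are v^-1, taken on D, and w, taken off D. *)
Theorem splitting_msff v w : A v -> B w -> v <> 1 -> w <> 1 -> generates_msff R (v * w).
Proof.
move=> Av Bw v1 w1; split; first exact: subgroup_gen.
move=> d X a Xsb aB aF mu.
have [a1 aM ma] := aB.
have AvV : A v^-1 by exact: subgroupV (sp_subgroupA sp) Av.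
have vV1 : v^-1 <> 1 by move=> /eqP; rewrite invg_eq1 => /eqP.
have [X0 [D [rk [mX0 X0inv X0mu mD rkP]]]] := increasing_choice mu en_surj Xsb aB aF
  (positive_words_inj sp tf AvV Bw vV1 w1).
pose S : set (X * X) := [set p | [/\ X0 p.1, X0 p.2 & blob a A B C D p.1 p.2]].
exists X0, S; split => //.
have S_orbit : S `<=` restr X0 (orbit_rel a setT).
  by move=> [x y] [/= X0x X0y [h _ hE]]; split => //; exists h.
have Sequiv : equivalence_on X0 S.
  split.
  - by move=> [x y] [].
  - by move=> x X0x; split => //; exact: (blob_refl a1 sp).
  - by move=> x y [X0x X0y xy]; split => //; exact: (blob_sym a1 aM sp).
  - by move=> x y z [X0x X0y xy] [_ X0z yz]; split => //; exact: (blob_trans aM sp xy yz).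
have Oequiv (L : set G) : subgroup L -> equivalence_on X0 (restr X0 (orbit_rel a L)).
  move=> sL; split.
  - by move=> [x y] [].
  - by move=> x X0x; split => //; exists 1; [exact: subgroup1|exact: a1].
  - move=> x y [[g gL /= gE] [/= X0x X0y]]; split => //; exists g^-1; first exact: subgroupV.
    by rewrite /= -gE -aM mulVg a1.
  - move=> x y z [[g gL /= gE] [/= X0x X0y]] [[h hL /= hE] [_ /= X0z]]; split => //.
    by exists (h * g); [exact: subgroupM|rewrite /= aM gE].
split => //; first exact: measurable_blob.
split.
  apply/seteqP; split => [[x y] [[g _ /= gE] [/= X0x X0y]] M [[M0 Mrefl Msym Mtrans] EM]|].
    rewrite -gE.
    apply: (cells_generate a1 aM sp Av Bw X0inv rkP (E := fun x y => M (x, y))) => //.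
      move=> u X0u; apply: EM; left; split; last by split => //; exact: X0inv.
      by exists (v * w) => //; exact: sub_gen.
    move=> u t X0u ut; apply: EM; right; split => //.
    by have [h _ /= <-] := ut; exact: X0inv.
  apply: smallest_sub; first exact: Oequiv.
  move=> p [[[g gL gE] pX0]|/S_orbit //]; split => //; by exists g.
move=> n n0 x x1 x2; apply: contrapT => /forallNP xn.
have [y [yw yc]] := cyclic_sequence_walk n0 x1 x2 xn.
apply: (cells_free a1 aM aF sp tf Av Bw v1 w1 X0inv rkP (b := false) (m := (2 * n)%N) (y := y)) => //.
  by rewrite muln_gt0.
move=> i im; have [ne st] := yw i im; split => //; move: st.
case: ifP => _ /=.
  by move=> [[g gL gE] [X0y _]]; split => //; exists g.
by move=> [X0y _ yb].
Qed.
End MSFF.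

Lemma free_product_msff (R : realType) (G : groupType) (s t : seq G) (v w : G) :
  free_basis (s ++ t) -> gen [set` s] v -> gen [set` t] w -> v <> 1 -> w <> 1 ->
  generates_msff R (v * w).
Proof.
move=> stb sv tw v1 w1; have [U sp] := splitting_free_product stb.
have [en en_surj] := free_basis_countable stb.
exact: (splitting_msff R sp (free_basis_torsion_free stb) en_surj).
Qed.

(** The second factor of v (t w t^-1) lies in the conjugate B = t A t^-1. *)
Lemma HNN_msff (R : realType) (G : groupType) (s : seq G) (t v w : G) :
  free_basis (rcons s t) -> gen [set` s] v -> gen [set` s] w -> v <> 1 -> w <> 1 ->
  generates_msff R (v * t * w * t^-1).
Proof.
move=> stb sv sw v1 w1; have [U sp] := splitting_HNN stb.
have [en en_surj] := free_basis_countable stb.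
have -> : v * t * w * t^-1 = v * (t * w * t^-1) by rewrite !mulgA.
apply: (splitting_msff R sp (free_basis_torsion_free stb) en_surj) => //=.
  by rewrite !mulgA mulVg mul1g mulgVK.
by move=> /(canRL (mulgVK t)); rewrite mul1g -[RHS]mulg1 => /mulgI.
Qed.

Lemma gen_expgz (G : groupType) (g : G) (p : int) : gen [set` [:: g]] (expgz g p).
Proof.
have gg : gen [set` [:: g]] g by apply: sub_gen; rewrite /= mem_head.
have sg := subgroup_gen [set` [:: g]].
case: p => n; first exact: (subgroupX n sg gg).
exact: (subgroupV sg (subgroupX n.+1 sg gg)).
Qed.

Lemma expgz_neq1 (G : groupType) (g : G) (p : int) :
  torsion_free G -> g <> 1 -> p <> 0%R -> expgz g p <> 1.
Proof.
move=> tf g1; case: p => [[|n] //|n] _ /=; first by move/tf.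
by move/eqP; rewrite invg_eq1 => /eqP /tf.
Qed.

Theorem corollary5p21 (R : realType) :
  (* F_2 = <a, b> *)
  (forall (G : groupType) (a b : G), free_basis [:: a; b] ->
     forall p n : int, (p <> 0)%R -> (n <> 0)%R ->
       generates_msff R (expgz a p * expgz b n) /\
       generates_msff R (expgz a p * b * expgz a n * b^-1)) /\
  (* F_r = F_(r-1) * <t> *)
  (forall (r : nat), (0 < r)%N ->
     forall (G : groupType) (s : r.-1.-tuple G) (t : G),
       free_basis (rcons s t) ->
     forall v w : G, gen [set` s] v -> gen [set` s] w -> v <> 1 -> w <> 1 ->
       generates_msff R (v * t * w * t^-1)) /\
  (* F_r = F_(r-k) * F_k *)
  (forall (r k : nat), (k <= r)%N ->
     forall (G : groupType) (s : (r - k).-tuple G) (t : k.-tuple G),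
       free_basis (s ++ t) ->
     forall v w : G, gen [set` s] v -> gen [set` t] w -> v <> 1 -> w <> 1 ->
       generates_msff R (v * w)).
Proof.
split=> [G a b ab p n p0 n0|].
  have tf := free_basis_torsion_free ab.
  have a1 : a <> 1 := free_basis_neq1 ab (i := 0) isT.
  have b1 : b <> 1 := free_basis_neq1 ab (i := 1) isT.
  split.
    by apply: (@free_product_msff R G [:: a] [:: b]) => //;
      [exact: gen_expgz|exact: gen_expgz|exact: expgz_neq1|exact: expgz_neq1].
  by apply: (@HNN_msff R G [:: a] b) => //;
    [exact: gen_expgz|exact: gen_expgz|exact: expgz_neq1|exact: expgz_neq1].
split=> [r _ G s t stb v w|r k _ G s t stb v w]; first exact: HNN_msff.
exact: free_product_msff.
Qed.
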